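(* Let $k>22$ and let $H$ be a finite group with a normal subgroup $M\ne 1$ such that $H/M\cong A_k$, the extension $1\to M\to H\to A_k\to 1$ is nonsplit, and $\gcd(2k,|M|)=1$. Then $P(H)\ge \frac12 k(k-1)(k-2)$.
   Context: For a finite group $H$, $P(H)$ denotes the minimal degree of a faithful permutation representation of $H$. An extension is nonsplit if $M$ has no complement in $H$. *)

(* Defs.v *)
From mathcomp Require Import all_boot all_fingroup all_solvable.
Set Implicit Arguments. Unset Strict Implicit. Unset Printing Implicit Defensive.
Local Open Scope group_scope.

Definition faithful_perm_rep (gT : finGroupType) (H : {group gT}) (n : nat) : Prop :=
  exists f : {morphism H >-> {perm 'I_n}}, 'injm f.

Definition Alt_k (k : nat) : {group {perm 'I_k}} := Alt_group 'I_k.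

(* Main.v *)
Require Import Defs.
From mathcomp Require Import all_boot all_fingroup all_solvable.
From mathcomp Require Import all_algebra zify ring.
Set Implicit Arguments. Unset Strict Implicit. Unset Printing Implicit Defensive.
Import GRing.Theory.
Local Open Scope group_scope.

(* Replace H by a minimal supplement of M, so that M lies in the Frattini
   subgroup of H, is nilpotent, and no homomorphism from H to F_p is nontrivial
   on M.  A faithful action of degree below k(k-1)(k-2)/2 has an orbit on which M
   acts nontrivially, with point stabiliser L say.  As |M : M :&: L| is at least 3,
   the image of L in Alt_k has index below 'C(k, 3), so by Bochert's argument it
   contains the pointwise stabiliser of two points x, y.  The quotient of M by
   (M :&: L) M' is then too small for Alt_(k-2) to act on it, which yields a
   homomorphism chi from the preimage H_xy of that stabiliser to F_p which is
   nontrivial on M; here p divides |M|, so p is prime to 2k.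

   By Shapiro's lemma chi is induced by a cocycle phi on H with values in the
   functions on pairs of points, which may be taken symmetric or antisymmetric.
   Summing over the second point gives a cocycle on points.  For points, the
   functions phi v with v in M are either all constant, and then chi extends to
   H, or they comprise every function of sum zero, and then the zero set of phi
   is a proper supplement of M; both are impossible.  Hence the functions phi v
   on pairs have zero row sums.  Modifying phi by a coboundary, all row sums of
   phi vanish on H.  If the phi v, v in M, comprise all such functions, the zero
   set of phi is again a supplement.  Otherwise they satisfy a linear relation
   which in the antisymmetric case forces k phi v = 0, and in the symmetric case
   makes phi v (x, y) + phi v (x, z) - phi v (y, z) depend on x only, so that it
   extends from M to the stabiliser of x, which reduces to the case of points. *)

(** * Three-cycles and subgroups of small index in the alternating group *)

Section ThreeCycles.
Variable T : finType.
Implicit Types (s x y z : {perm T}) (a b c d e w : T) (O D : {set T}) (Q : {group {perm T}}).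

(** The alternating group is [#|T| - 2]-fold transitive; lists of distinct points are the form in
    which this gets used. *)
Lemma alt_move (t u : seq T) :
  uniq t -> uniq u -> size t = size u -> size t + 2 <= #|T| ->
  exists2 s : {perm T}, s \in 'Alt_T & map s t = u.
Proof.
move=> Ut Uu szE szT.
have le_t : size t <= #|T|.-2 by move: szT; rewrite addn2; case: #|T| => [|[|m]].
have tr := ntransitive_weak le_t (Alt_trans T).
have dt1 : in_tuple t \in (size t).-dtuple(setT) by rewrite inE Ut; apply/subsetP.
have su : size u == size t by rewrite szE.
have dt2 : Tuple su \in (size t).-dtuple(setT) by rewrite inE Uu; apply/subsetP.
have [s As E] := atransP2 tr dt1 dt2; exists s => //.
exact: esym (congr1 val E).
Qed.

(** Products act from left to right, so on distinct points this cycle sends [a] to [b], [b] to [c]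
    and [c] to [a]. *)
Definition tc a b c : {perm T} := tperm a b * tperm a c.

Lemma tcJ a b c s : tc a b c ^ s = tc (s a) (s b) (s c).
Proof. by rewrite /tc conjMg !tpermJ. Qed.

Lemma tc_val a b c : uniq [:: a; b; c] ->
  [/\ tc a b c a = b, tc a b c b = c & tc a b c c = a].
Proof.
rewrite /= !inE negb_or andbT -andbA => /and3P[ab ac bc].
rewrite /tc; split; rewrite permM.
- by rewrite tpermL tpermD // eq_sym.
- by rewrite tpermR tpermL.
- by rewrite (tpermD ac bc) tpermR.
Qed.

Lemma tc_fix a b c w : w != a -> w != b -> w != c -> tc a b c w = w.
Proof. by move=> wa wb wc; rewrite /tc permM !tpermD // eq_sym. Qed.

Lemma tc_eq z a b c : uniq [:: a; b; c] -> z a = b -> z b = c -> z c = a ->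
  (forall w, w != a -> w != b -> w != c -> z w = w) -> z = tc a b c.
Proof.
move=> U za zb zc zw; have [ta tb tC] := tc_val U; apply/permP=> w.
have [->|wa] := eqVneq w a; first by rewrite za ta.
have [->|wb] := eqVneq w b; first by rewrite zb tb.
have [->|wc] := eqVneq w c; first by rewrite zc tC.
by rewrite zw // tc_fix.
Qed.

Lemma tc_rot a b c : uniq [:: a; b; c] -> tc a b c = tc b c a.
Proof.
move=> U; have [ta tb tC] := tc_val U; apply: tc_eq => //.
  by rewrite -(rot_uniq 1) in U.
by move=> w wb wc wa; rewrite tc_fix.
Qed.

Lemma tcV a b c : (tc a b c)^-1 = tc a c b.
Proof. by rewrite /tc invMg !tpermV. Qed.

Lemma tc_even a b c : uniq [:: a; b; c] -> tc a b c \in 'Alt_T.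
Proof.
rewrite Alt_even /= !inE negb_or andbT -andbA => /and3P[ab ac bc].
by rewrite odd_permM !odd_tperm ab ac.
Qed.

Lemma tc_on a b c O : a \in O -> b \in O -> c \in O -> perm_on O (tc a b c).
Proof.
move=> aO bO cO; apply/subsetP=> w; rewrite inE; apply: contraNT => wO.
by rewrite tc_fix //; apply: contraNneq wO => ->.
Qed.

(* Successive 3-cycles shrink the support of an even permutation. *)
Lemma alt_on_sub Q O : (forall a b c, uniq [:: a; b; c] -> a \in O -> b \in O -> c \in O ->
    tc a b c \in Q) -> forall s, s \in 'Alt_T -> perm_on O s -> s \in Q.
Proof.
move=> H3 s; have [n] := ubnP #|[set x | s x != x]|.
elim: n s => // n IHn s; rewrite ltnS => le_s As onO.
have [s0 | [a]] := set_0Vmem [set x | s x != x].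
  suffices -> : s = 1 by apply: group1.
  by apply/permP=> x; rewrite perm1; have := in_set0 x; rewrite -s0 inE => /negbFE/eqP.
rewrite inE => sa.
case: (pickP [pred c | [&& s c != c, c != a & c != s a]]) => [c /and3P[sc ca cb]|none]; last first.
  have sE : s = tperm a (s a).
    apply/permP=> w; case: tpermP => [-> // | -> | /eqP wa /eqP wb].
      apply: contraFeq (none (s (s a))) => ssa /=.
      by rewrite !(inj_eq perm_inj) sa ssa.
    by apply: contraFeq (none w) => sw; rewrite /= sw wa wb.
  by move: As; rewrite Alt_even sE odd_tperm eq_sym sa.
have onOx w : s w != w -> w \in O by move=> sw; apply: (subsetP onO).
have sbO : s a \in O by apply: onOx; rewrite (inj_eq perm_inj).
have U : uniq [:: s a; a; c] by rewrite /= !inE negb_or sa eq_sym cb eq_sym ca.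
have QT : tc (s a) a c \in Q by apply: H3 => //; apply: onOx.
rewrite -(groupMr _ QT); have [t1 t2 t3] := tc_val U.
apply: IHn; last 2 first.
- by rewrite groupM ?tc_even.
- by rewrite perm_onM // tc_on // onOx.
apply: leq_trans le_s; apply: proper_card; apply/properP; split; last first.
  by exists a; rewrite !inE // permM t1 eqxx.
apply/subsetP=> w; rewrite !inE; apply: contraNN => /eqP sw.
rewrite permM sw tc_fix //; apply: contraNneq sa => E.
- by move: sw; rewrite E => /perm_inj ->.
- by rewrite -E sw.
- by move: sc; rewrite -E sw eqxx.
Qed.

(** As the supports meet in [c] alone, [x ^ y] is [x] with [c] renamed to [y c]; hence
    [x^-1 * x ^ y] moves only [c], [y c] and [x c]. *)
Lemma commg_tc x y c : x c != c -> y c != c ->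
  (forall w, x w != w -> y w != w -> w = c) ->
  uniq [:: c; y c; x c] /\ [~ x, y] = tc c (y c) (x c).
Proof.
move=> xc yc only.
have fy w : x w != w -> w != c -> y w = w.
  by move=> xw; apply: contraNeq => yw; apply/eqP/only.
have fx w : y w != w -> w != c -> x w = w.
  by move=> yw; apply: contraNeq => xw; apply/eqP/only.
have inv_mv s w : s w != w -> s (s^-1 w) != s^-1 w.
  by apply: contraNneq => E; rewrite -{1}(permKV s w) E permKV.
have inv_fix s w : s w = w -> s^-1 w = w by move=> E; rewrite -{1}E permK.
have xxc : x (x c) != x c by rewrite (inj_eq perm_inj).
have yyc : y (y c) != y c by rewrite (inj_eq perm_inj).
have U : uniq [:: c; y c; x c].
  rewrite /= !inE negb_or !(eq_sym c) yc xc /= andbT.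
  by apply: contraNneq xxc => E; rewrite -E fx.
have invE s w w' : s^-1 w = w' -> w = s w' by move=> <-; rewrite permKV.
have xVc : x^-1 c != c by apply: contraNneq xc => /invE <-.
have yVc : y^-1 c != c by apply: contraNneq yc => /invE <-.
split=> //; rewrite commgEl /conjg; apply: tc_eq => //; rewrite ?permM.
- by rewrite (inv_fix y) ?permKV // fy // inv_mv.
- by rewrite (inv_fix x _ (fx _ yyc yc)) permK fy.
- by rewrite permK (fx _ (inv_mv _ _ yc) yVc) permKV.
move=> w wc wy wx; rewrite !permM.
have [xw|xw] := eqVneq (x w) w.
  rewrite (inv_fix _ _ xw).
  have [yw|yw] := eqVneq (y w) w; first by rewrite inv_fix ?xw.
  have wyc : y^-1 w != c by apply: contraNneq wy => /invE <-.
  by rewrite (fx _ (inv_mv _ _ yw) wyc) permKV.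
have E : y (x^-1 w) = x^-1 w.
  by apply: fy; rewrite ?inv_mv //; apply: contraNneq wx => /invE <-.
by rewrite (inv_fix _ _ E) permKV fy.
Qed.

End ThreeCycles.

(** To be set against [moves_free_card] when [D] contains at least a third of the points; [8 <= d]
    then comes from [22 <= #|T|]. *)
Lemma fact_lower_bound d : 8 <= d -> 3 * d * (3 * d - 1) * (3 * d - 2) <= 3 * d`!.
Proof.
move=> d8; suffices H : 9 * d ^ 3 <= d`! by nia.
elim: d d8 => // d IHd; rewrite leq_eqVlt => /predU1P[<- //|]; rewrite ltnS => d8.
by have := IHd d8; rewrite factS !expnS !expn0; nia.
Qed.

(** Symmetry of binomial coefficients reduces to [2 * b <= n], and up to the middle they
    increase. *)
Lemma leq_bin_half n a b : a <= b -> a + b <= n -> 'C(n, a) <= 'C(n, b).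
Proof.
move=> ab le_n; wlog le2 : b ab le_n / 2 * b <= n => [IH|].
  have [/IH->//|lt2] := leqP (2 * b) n.
  by rewrite -(bin_sub (n := n) (m := b)); [apply: IH; lia | lia].
elim: b ab le_n le2 => [|b IHb]; first by rewrite leqn0 => /eqP->.
rewrite leq_eqVlt => /predU1P[-> //|]; rewrite ltnS => ab le_n le2.
apply: leq_trans (IHb _ _ _) _; try lia.
by rewrite -(leq_pmul2l (ltn0Sn b)) mul_bin_left leq_mul2r; apply/orP; right; lia.
Qed.

(** * The equivalence relation defined by the 3-cycles of a permutation group *)

Section SmallIndex.
Variables (T : finType) (Q : {group {perm T}}).
Implicit Types (s : {perm T}) (a b c d e x : T) (A B D O L : {set T}).

Lemma tcQ_rot a b c : uniq [:: a; b; c] -> tc a b c \in Q -> tc b c a \in Q.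
Proof. by move=> /tc_rot->. Qed.

Lemma tcQ_swap a b c : tc a b c \in Q -> tc a c b \in Q.
Proof. by rewrite -tcV groupV. Qed.

Lemma uniq3_rot a b c : uniq [:: a; b; c] -> uniq [:: b; c; a].
Proof. by rewrite -(rot_uniq 1). Qed.

Lemma uniq3_swap a b c : uniq [:: a; b; c] -> uniq [:: a; c; b].
Proof. by rewrite /= !inE !negb_or (eq_sym b); case: (a != b); case: (a != c). Qed.

(** Its classes are the orbits of the subgroup generated by the 3-cycles in [Q]. *)
Definition tc_rel a b := (a == b) || [exists c, uniq [:: a; b; c] && (tc a b c \in Q)].

Lemma tc_relP a b : reflect (a = b \/ exists2 c, uniq [:: a; b; c] & tc a b c \in Q) (tc_rel a b).
Proof.
apply: (iffP orP) => -[].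
- by move/eqP; left.
- by case/existsP=> c /andP[]; right; exists c.
- by move/eqP; left.
- by case=> c U q; right; apply/existsP; exists c; rewrite U.
Qed.

(** Conjugating the first cycle by the second gives [tc a d b], the inverse of the cycle sought. *)
Lemma tc_share a b c d : uniq [:: a; b; c; d] -> tc a b c \in Q -> tc b d c \in Q ->
  tc a b d \in Q.
Proof.
move=> U qabc qbdc; apply: tcQ_swap.
move: U; rewrite /= !inE !negb_or andbT -!andbA => /and5P[ab ac ad bc /andP[bd cd]].
have U : uniq [:: b; d; c] by rewrite /= !inE negb_or bd bc eq_sym cd.
have [t1 t2 t3] := tc_val U; have := groupJ qabc qbdc.
by rewrite tcJ t1 t3 tc_fix.
Qed.

(** Let [tc a b c] and [tc b d e] be the two witnesses. If [e = a] or [c = d], one of them is the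
    goal up to rotation or inversion; if [e = c], [tc_share] applies; otherwise they share only [b],
    and conjugating one by the other leads back to [tc_share]. *)
Lemma tc_rel3 a b d : uniq [:: a; b; d] -> tc_rel a b -> tc_rel b d -> tc a b d \in Q.
Proof.
move=> U /tc_relP Rab /tc_relP Rbd.
have := U; rewrite /= !inE negb_or andbT -andbA => /and3P[ab ad bd].
case: Rab => [E|[c Uc qc]]; first by rewrite E eqxx in ab.
case: Rbd => [E|[e Ue qe]]; first by rewrite E eqxx in bd.
have := Uc; rewrite /= !inE negb_or andbT -andbA => /and3P[_ ac bc].
have := Ue; rewrite /= !inE negb_or andbT -andbA => /and3P[_ be de].
have [Ea|ea] := eqVneq e a.
  by subst e; apply: tcQ_rot (uniq3_rot Ue) (tcQ_rot Ue qe).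
have [Ec|cd] := eqVneq c d; first by subst c.
have [Ec|ec] := eqVneq e c.
  by subst e; apply: (@tc_share a b c d) => //; rewrite /= !inE !negb_or ab ac ad bc bd cd.
have [t1 t2 t3] := tc_val Ue.
have qadc : tc a d c \in Q.
  by have := groupJ qc qe; rewrite tcJ t1 !tc_fix // eq_sym.
have qbac : tc b a c \in Q.
  apply: (tcQ_rot (a := c)); first exact/uniq3_swap/uniq3_rot/uniq3_rot.
  by apply: tcQ_swap; apply: (tcQ_rot (uniq3_rot Uc)); apply: tcQ_rot.
have qbad : tc b a d \in Q.
  apply: (@tc_share b a c d) => //.
  by rewrite /= !inE !negb_or (eq_sym b a) ab bc bd ac ad cd.
apply: (tcQ_rot (a := d)); first exact/uniq3_rot/uniq3_rot.
by apply: (tcQ_rot (a := b)); [apply: uniq3_rot | apply: tcQ_swap].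
Qed.

Lemma tc_rel_refl a : tc_rel a a. Proof. by rewrite /tc_rel eqxx. Qed.

Lemma tc_rel_of a b c : uniq [:: a; b; c] -> tc a b c \in Q -> tc_rel a b.
Proof. by move=> U q; apply/tc_relP; right; exists c. Qed.

Lemma tc_rel_sym a b : tc_rel a b -> tc_rel b a.
Proof.
case/tc_relP=> [->|[c U q]]; first exact: tc_rel_refl.
apply: (tc_rel_of (c := c)); first exact/uniq3_swap/uniq3_rot.
by apply: tcQ_swap; apply: tcQ_rot.
Qed.

Lemma tc_rel_trans a b c : tc_rel a b -> tc_rel b c -> tc_rel a c.
Proof.
have [->//|ab] := eqVneq a b; have [<-//|bc] := eqVneq b c.
have [<-|ac] := eqVneq a c; first by move=> _ _; apply: tc_rel_refl.
have U : uniq [:: a; b; c] by rewrite /= !inE negb_or ab ac bc.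
by move=> Rab Rbc; apply: (tc_rel_of (uniq3_swap U)); apply: tcQ_swap; apply: tc_rel3.
Qed.

Lemma tc_rel_act s a b : s \in Q -> tc_rel a b -> tc_rel (s a) (s b).
Proof.
move=> sQ /tc_relP[->|[c U q]]; first exact: tc_rel_refl.
apply: (tc_rel_of (c := s c)); last by rewrite -tcJ groupJ.
by have := map_inj_uniq (@perm_inj _ s) [:: a; b; c]; rewrite /= => ->.
Qed.

Definition tc_class a := [set b | tc_rel a b].

Lemma tc_class_eq a b : tc_rel a b -> tc_class a = tc_class b.
Proof.
move=> R; apply/setP=> c; rewrite !inE; apply/idP/idP; last exact: tc_rel_trans.
by apply: tc_rel_trans; apply: tc_rel_sym.
Qed.

(** By [tc_rel3] all 3-cycles on a class lie in [Q], and they generate the even permutations of the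
    class. *)
Lemma alt_class a s : s \in 'Alt_T -> perm_on (tc_class a) s -> s \in Q.
Proof.
apply: alt_on_sub => b c d U; rewrite !inE => Rb Rc Rd.
by apply: tc_rel3 => //; [apply: tc_rel_trans Rc | apply: tc_rel_trans Rd]; apply: tc_rel_sym.
Qed.

Hypothesis sQA : Q \subset 'Alt_T.

Definition tc_free L := [forall a in L, forall b in L, forall c in L,
  uniq [:: a; b; c] ==> (tc a b c \notin Q)].

Lemma tc_freeP L : reflect (forall a b c, a \in L -> b \in L -> c \in L ->
  uniq [:: a; b; c] -> tc a b c \notin Q) (tc_free L).
Proof.
apply: (iffP forall_inP) => [H a b c aL bL cL U | H a aL].
  by have /forall_inP/(_ b bL)/forall_inP/(_ c cL)/implyP := H a aL; apply.
by apply/forall_inP=> b bL; apply/forall_inP=> c cL; apply/implyP; apply: H.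
Qed.

Definition moves_free D := [forall s in Q, perm_on D s ==> (s == 1)].

Lemma moves_freeP D : reflect (forall s, s \in Q -> perm_on D s -> s = 1) (moves_free D).
Proof.
apply: (iffP forall_inP) => [H s sQ sD | H s sQ]; first by apply/eqP; apply: (implyP (H s sQ)).
by apply/implyP=> sD; apply/eqP/H.
Qed.

(** The symmetric group on [D] meets [Q] trivially, so the product of the two orders is at most that
    of ['Sym_T]; the 2 is the index of ['Alt_T] there. *)
Lemma moves_free_card D : 1 < #|T| -> moves_free D -> #|D|`! <= 2 * #|'Alt_T : Q|.
Proof.
move=> T1 /moves_freeP free.
have TI : perm.Sym_group D :&: Q = 1.
  apply/trivgP/subsetP=> s /setIP[]; rewrite inE => sD sQ.
  by rewrite inE (free s).
have : #|perm.Sym_group D| * #|Q| <= #|'Sym_T|.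
  by rewrite -(TI_cardMg TI); apply/subset_leq_card/subsetT.
rewrite perm.card_Sym card_Sym -(card_Alt T1) -(Lagrange sQA).
by rewrite mulnCA mulnC leq_pmul2l.
Qed.

(* Bochert's argument: otherwise L contains two elements of Q whose supports
   share one point, and their commutator is a 3-cycle. *)
Lemma tc_free_card L : tc_free L ->
  exists D, moves_free D /\ #|L| <= 2 * #|D|.
Proof.
move=> /tc_freeP freeL.
pose P D := (D \subset L) && moves_free D.
have P0 : P set0.
  rewrite /P sub0set; apply/moves_freeP=> s sQ s0.
  by apply: (perm_on_id s0); rewrite cards0.
case: (@arg_maxnP _ set0 P (fun D => #|D|) P0) => D /andP[sDL freeD] maxD.
exists D; split=> //; rewrite leqNgt; apply/negP=> ltLD.
have cDL : #|D| < #|L :\: D| by rewrite cardsD (setIidPr sDL); lia.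
have /moves_freeP nfree : ~~ moves_free (L :\: D).
  by apply: contraL cDL => fr; rewrite -leqNgt; apply: maxD; rewrite /P subsetDl.
(* [L :\: D] is larger than the maximal set [D], so it supports a nontrivial element of [Q]. *)
have [x [xQ xon x1]] : exists x : {perm T}, [/\ x \in Q, perm_on (L :\: D) x & x != 1].
  case: (pickP [pred x : {perm T} | [&& x \in Q, perm_on (L :\: D) x & x != 1]]) => [x /and3P|none].
    by exists x.
  by case: nfree => s sQ son; apply: contraFeq (none s) => s1 /=; rewrite sQ son.
have [c xc] : exists c, x c != c.
  apply/existsP; apply: contraNT x1 => /existsPn H; apply/eqP/permP=> w.
  by rewrite perm1; apply/eqP; rewrite -[_ == _]negbK H.
have /setDP[cL cD] : c \in L :\: D by apply: (subsetP xon); rewrite inE.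
(* By maximality [c |: D] also supports one. It must move [c], as [D] alone supports none, and its
   support meets that of [x] only in [c]. *)
have [y [yQ yon y1]] : exists y, [/\ y \in Q, perm_on (c |: D) y & y != 1].
  case: (pickP [pred y | [&& y \in Q, perm_on (c |: D) y & y != 1]]) => [y /and3P|none].
    by exists y.
  have : P (c |: D).
    rewrite /P subUset sub1set cL sDL; apply/moves_freeP=> s sQ son.
    by apply: contraFeq (none s) => s1 /=; rewrite sQ son.
  by move/maxD; rewrite /= cardsU1 cD add1n ltnn.
have yc : y c != c.
  apply: contraNneq y1 => yc; apply/eqP; apply: (moves_freeP _ freeD) => //.
  apply/subsetP=> w; rewrite inE => yw; have : w \in c |: D by apply: (subsetP yon); rewrite inE.
  by case/setU1P=> // E; rewrite E yc eqxx in yw.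
have [|U E] := commg_tc xc yc.
  move=> w xw yw; have : w \in c |: D by apply: (subsetP yon); rewrite inE.
  have : w \in L :\: D by apply: (subsetP xon); rewrite inE.
  by case/setDP=> _ wD /setU1P[//|]; rewrite (negPf wD).
have inL w z : perm_on L z -> w \in L -> z w \in L by move=> zL; rewrite perm_closed.
have xL : perm_on L x by apply: subset_trans xon (subsetDl _ _).
have yL : perm_on L y by apply: subset_trans yon _; rewrite subUset sub1set cL.
have := freeL c (y c) (x c) cL (inL _ _ yL cL) (inL _ _ xL cL) U.
by rewrite -E groupR.
Qed.

(** Suppose all classes have at most 3 points, and take [L] maximal without 3-cycles of [Q]. Each
    point outside [L] is related to two points of [L], which fill its class, so each point of [L] is
    related to at most one point outside. Counting these pairs gives [2 * #|~: L| <= #|L|], hence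
    [#|T| <= 3 * #|D|] with [D] from [tc_free_card], against the bound on the index. *)
Lemma large_class : 22 <= #|T| ->
  6 * #|'Alt_T : Q| < #|T| * (#|T| - 1) * (#|T| - 2) ->
  exists a, 4 <= #|tc_class a|.
Proof.
move=> T22 ltN; apply/existsP; apply/existsPn => /= small.
have {}small a : #|tc_class a| <= 3 by have := small a; rewrite -ltnNge.
have P0 : tc_free set0 by apply/tc_freeP=> a b c; rewrite inE.
case: (@arg_maxnP _ set0 tc_free (fun D => #|D|) P0) => L freeL maxL.
have [D [freeD le_LD]] := tc_free_card freeL.
have T1 : 1 < #|T| by lia.
have le_D := moves_free_card T1 freeD.
have two x : x \in ~: L -> 2 <= #|tc_class x :&: L|.
  rewrite inE => xL; have /tc_freeP nfree : ~~ tc_free (x |: L).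
    by apply/negP=> /maxL; rewrite /= cardsU1 xL add1n ltnn.
  suffices [b [c [bL cL U q]]] : exists b c, [/\ b \in L, c \in L, uniq [:: x; b; c] & tc x b c \in Q].
    have := U; rewrite /= !inE negb_or andbT -andbA => /and3P[xb xc bc].
    have <- : #|[set b; c]| = 2 by rewrite cards2 bc.
    apply/subset_leq_card/subsetP=> w /set2P[]->; rewrite !inE ?bL ?cL andbT.
      exact: tc_rel_of U q.
    by apply: tc_rel_of (uniq3_swap U) _; apply: tcQ_swap.
  case: (pickP [pred p : T * T | [&& p.1 \in L, p.2 \in L, uniq [:: x; p.1; p.2] & tc x p.1 p.2 \in Q]]).
    by case=> b c /and4P[]; exists b, c.
  move=> none; case: nfree => a b c aL bL cL U; apply/negP=> q.
  have nx p r : p \in L -> r \in L -> uniq [:: x; p; r] -> tc x p r \in Q -> False.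
    by move=> pL rL Ur qr; have := none (p, r); rewrite /= pL rL qr andbT /=; move: Ur => /= ->.
  have rot0 := uniq3_rot U; have rot1 := uniq3_rot rot0.
  have q0 := tcQ_rot U q; have q1 := tcQ_rot rot0 q0.
  have := U; rewrite /= !inE negb_or andbT -andbA => /and3P[ab ac bc].
  case/setU1P: aL => [E|aL].
    subst a; apply: (nx b c) => //.
      by case/setU1P: bL => // E; rewrite E eqxx in ab.
    by case/setU1P: cL => // E; rewrite E eqxx in ac.
  case/setU1P: bL => [E|bL].
    subst b; apply: (nx c a) => //.
    by case/setU1P: cL => // E; rewrite E eqxx in bc.
  case/setU1P: cL => [E|cL]; first by subst c; apply: (nx a b).
  by move/tc_freeP: freeL => /(_ a b c aL bL cL U); rewrite q.
have one b : b \in L -> #|tc_class b :&: ~: L| <= 1.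
  move=> bL; have [->|[x /setIP[Rx xL]]] := set_0Vmem (tc_class b :&: ~: L).
    by rewrite cards0.
  rewrite inE in Rx; have := two x xL; rewrite -(tc_class_eq Rx).
  by have := small b; rewrite -(cardsID L (tc_class b)) setDE; lia.
have sumE : \sum_(x in ~: L) #|tc_class x :&: L| = \sum_(b in L) #|tc_class b :&: ~: L|.
  have card_sum x A : #|tc_class x :&: A| = \sum_(b in A) tc_rel x b.
    rewrite -sum1_card big_mkcond [RHS]big_mkcond /=; apply: eq_bigr => b _.
    by rewrite !inE andbC; case: (b \in A); case: tc_rel.
  rewrite (eq_bigr _ (fun x _ => card_sum x L)) exchange_big /=; apply: eq_bigr => b _.
  rewrite card_sum; apply: eq_bigr => x _; congr nat_of_bool.
  by apply/idP/idP; apply: tc_rel_sym.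
have le1 : 2 * #|~: L| <= \sum_(x in ~: L) #|tc_class x :&: L|.
  by rewrite mulnC -sum_nat_const; apply: leq_sum.
have le2 : \sum_(b in L) #|tc_class b :&: ~: L| <= #|L|.
  by rewrite -sum1_card; apply: leq_sum.
have cL : #|L| + #|~: L| = #|T| by rewrite cardsC.
rewrite sumE in le1; have leT : #|T| <= 3 * #|D| by lia.
have D8 : 8 <= #|D| by lia.
have le3 : #|T| * (#|T| - 1) * (#|T| - 2) <= 3 * #|D| * (3 * #|D| - 1) * (3 * #|D| - 2).
  by rewrite !leq_mul ?leq_sub2r.
have := leq_trans ltN (leq_trans le3 (fact_lower_bound D8)); lia.
Qed.
End SmallIndex.

Lemma bin3E n : (6 * 'C(n, 3) = n * (n - 1) * (n - 2))%N.
Proof. by have := bin_ffact n 3; rewrite !ffactnS ffactn0 !factS fact0 -!subn1; lia. Qed.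

(** This and [bin3_leq_bin4] serve in [small_index_Alt] to exclude a largest class of size 4,
    respectively at least 5, that has several conjugates. *)
Lemma bin3_leq_double n : 6 <= n -> 'C(n, 3) <= 2 * 'C(n.-1, 3).
Proof.
case: n => // n n6 /=; rewrite binS; suffices : 'C(n, 2) <= 'C(n, 3) by lia.
by apply: leq_bin_half; lia.
Qed.

Lemma bin3_leq_bin4 n : 10 <= n -> 'C(n, 3) <= 'C(n.-1, 4).
Proof.
case: n => // n n9 /=; rewrite binS.
have h3 : 7 * 'C(n, 2) <= 3 * 'C(n, 3).
  by rewrite mul_bin_left leq_mul2r; apply/orP; right; lia.
have h4 : 6 * 'C(n, 3) <= 4 * 'C(n, 4).
  by rewrite mul_bin_left leq_mul2r; apply/orP; right; lia.
lia.
Qed.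

(** * Subgroups of index below ['C(#|T|, 3)] in the alternating group *)

Section Index.
Variable T : finType.
Implicit Types (s : {perm T}) (a b c d e x : T) (A B D O L : {set T}) (Q : {group {perm T}}).

Lemma set_move O O' : #|O| = #|O'| -> #|O| + 2 <= #|T| ->
  exists2 s, s \in 'Alt_T & s @: O = O'.
Proof.
move=> E le2; have [||||s As sE] := @alt_move T (enum O) (enum O').
- exact: enum_uniq.
- exact: enum_uniq.
- by rewrite -!cardE.
- by rewrite -cardE.
exists s => //; apply/setP=> y; rewrite -[RHS]mem_enum -sE.
by apply/imsetP/mapP=> -[x xO ->]; exists x => //; rewrite mem_enum in xO *.
Qed.

(** [set_move] needs two points outside the set; when [O] is too large for that, its complement is
    moved instead. *)
Lemma alt_orbit_set O : 2 <= #|O| -> 4 <= #|T| ->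
  orbit ('P^*) 'Alt_T O = [set B : {set T} | #|B| == #|O|].
Proof.
move=> O2 T4; apply/setP=> B; rewrite inE; apply/orbitP/eqP=> [[s _ <-]|E].
  by rewrite card_setact.
have [le2|gt2] := leqP (#|O| + 2) #|T|.
  have [s As sE] := set_move (esym E) le2; exists s => //.
have le2 : #|~: O| + 2 <= #|T| by have := cardsC O; lia.
have cE : #|~: O| = #|~: B| by have := cardsC O; have := cardsC B; lia.
have [s As sE] := set_move cE le2; exists s => //.
rewrite /= /setact /=; apply/setP=> y; apply/imsetP/idP=> [[x xO ->]|yB].
  apply: contraLR xO => xB; have : s x \in ~: B by rewrite inE.
  by rewrite -sE (mem_imset _ _ (@perm_inj _ s)) inE.
exists (s^-1 y); last by rewrite /aperm permKV.
apply: contraLR yB => xO; have : s (s^-1 y) \in s @: ~: O by rewrite imset_f // inE.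
by rewrite sE permKV inE.
Qed.

(** Let [O] be a largest class, [c] its size and [r] the number of its conjugates under [Q]. These
    are disjoint, so [r * c <= k], and comparing stabilisers gives [cN]. If [r = 1] then
    ['C(k, c) <= N < 'C(k, 3)], which forces [c >= k - 2]. If [r >= 2] then [2 * c <= k] and
    ['C(k.-1, c.-1) * #|SA| <= N * #|SQ|], which is too large for [c >= 5], and for [c = 4] once
    [SQ] is known to be proper in [SA]. *)
Lemma small_index_Alt Q : Q \subset 'Alt_T -> 22 <= #|T| ->
  6 * #|'Alt_T : Q| < #|T| * (#|T| - 1) * (#|T| - 2) ->
  exists O, [/\ #|T| - 2 <= #|O|, forall s, s \in 'Alt_T -> perm_on O s -> s \in Q
    & 'C(#|T|, #|O|) <= #|'Alt_T : Q|].
Proof.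
move=> sQA T22 ltN; have [a0 c4] := large_class sQA T22 ltN.
case: (@arg_maxnP _ a0 predT (fun a => #|tc_class Q a|) isT) => a _ maxa.
set O := tc_class Q a; set c := #|O|; set k := #|T| in T22 ltN *.
have {}c4 : 4 <= c by apply: leq_trans c4 (maxa a0 isT).
have c_le_k : c <= k by apply: max_card.
pose SA := 'C_('Alt_T)[O | 'P^*]; pose SQ := 'C_Q[O | 'P^*].
set r := #|orbit 'P^* Q O|; set N := #|'Alt_T : Q| in ltN *.
have sSQ : SQ \subset SA by apply: setSI.
have cA : ('C(k, c) * #|SA| = #|'Alt_T|)%N.
  have := card_orbit_stab ('P^*) ('Alt_T)%G O; rewrite alt_orbit_set; try lia.
  by rewrite card_draws.
have cQ : (r * #|SQ| = #|Q|)%N by apply: card_orbit_stab.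
have cN : (N * (r * #|SQ|) = 'C(k, c) * #|SA|)%N by rewrite cQ cA mulnC Lagrange.
have leS : #|SQ| <= #|SA| by apply: subset_leq_card.
have SQ0 : 0 < #|SQ| by apply: cardG_gt0.
have r0 : 0 < r by apply/card_gt0P; exists O; apply: orbit_refl.
have orb_class B : B \in orbit 'P^* Q O -> exists2 b, B = tc_class Q b & #|B| = c.
  case/orbitP=> s sQ <-; exists (s a); last by rewrite card_setact.
  rewrite /= /setact /=; apply/setP=> y; rewrite inE; apply/imsetP/idP=> [[x xO ->]|Ry].
    by apply: tc_rel_act => //; rewrite inE in xO.
  exists (s^-1 y); last by rewrite /aperm permKV.
  by rewrite inE -[a](permK s); apply: tc_rel_act; rewrite ?groupV.
have rc : r * c <= k.
  have tI : trivIset (orbit 'P^* Q O).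
    apply/trivIsetP=> B C /orb_class[b -> _] /orb_class[d -> _]; apply: contraR.
    rewrite -setI_eq0 => /set0Pn[x /setIP[]]; rewrite !inE => bx dx.
    by rewrite (tc_class_eq bx) (tc_class_eq dx).
  move: tI; rewrite /trivIset (eq_bigr (fun=> c)); last by move=> B /orb_class[].
  by rewrite sum_nat_const => /eqP->; apply: max_card.
have only1 : r = 1%N -> 'C(k, c) <= N.
  move=> r1; rewrite -(leq_pmul2r SQ0); have := cN; rewrite r1 mul1n => ->.
  by rewrite leq_mul2l leS orbT.
exists O; rewrite -/c -/k; have [le_c|gt_c] := leqP (k - 2) c.
  split=> //; first by move=> s As; apply: alt_class.
  by apply: only1; nia.
exfalso; have bin3 := bin3E k.
have C3 : 'C(k, 3) > N by lia.
have [r1|r2] := leqP r 1.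
  have := only1 (anti_leq (introT andP (conj r1 r0))).
  by have := @leq_bin_half k 3 c; lia.
have c2 : 2 * c <= k by nia.
have main : c * 'C(k, c) * #|SA| <= k * N * #|SQ|.
  have : N * #|SQ| * (r * c) <= N * #|SQ| * k by rewrite leq_mul2l rc orbT.
  nia.
have Ck : (c * 'C(k, c) = k * 'C(k.-1, c.-1))%N.
  by rewrite mul_bin_diag prednK //; lia.
rewrite Ck -!mulnA leq_pmul2l in main; last by lia.
have [c5|c_le4] := leqP 5 c.
  have : 'C(k.-1, c.-1) <= N.
    by rewrite -(leq_pmul2r SQ0); apply: leq_trans main; rewrite leq_mul2l leS orbT.
  have : 'C(k.-1, 4) <= 'C(k.-1, c.-1) by apply: leq_bin_half; lia.
  by have := @bin3_leq_bin4 k; lia.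
have E4 : c = 4 by lia.
have cO : #|~: O| = (k - 4)%N by have := cardsC O; lia.
(* Otherwise [Q] contains every 3-cycle off [O], and the [k - 4] points off [O] lie in a single
   class larger than [O]. *)
have ne : SQ \proper SA.
  rewrite properE sSQ; apply/negP=> sSA.
  have /card_gt0P[x xO] : 0 < #|~: O| by lia.
  suffices sO : ~: O \subset tc_class Q x.
    by have := subset_leq_card sO; have := maxa x isT; rewrite /= -/O -/c; lia.
  apply/subsetP=> y yO; rewrite inE; have [->|xy] := eqVneq x y; first exact: tc_rel_refl.
  have /card_gt0P[z] : 0 < #|~: O :\: [set x; y]|.
    have := subset_leq_card (subsetIr (~: O) [set x; y]); rewrite cards2 cardsD; lia.
  rewrite !inE negb_or -andbA => /and3P[zx zy zO].
  have U : uniq [:: x; y; z] by rewrite /= !inE negb_or xy !(eq_sym _ z) zx zy.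
  apply: (tc_rel_of U); suffices : tc x y z \in SA by move/(subsetP sSA); case/setIP.
  rewrite inE tc_even //=; apply/astab1P; rewrite /= /setact /= -[RHS]imset_id.
  apply: eq_in_imset => w wO; rewrite /aperm tc_fix //.
  - by apply: contraTneq wO => ->; rewrite inE in xO.
  - by apply: contraTneq wO => ->; rewrite inE in yO.
  - by apply: contraTneq wO => ->; rewrite inE.
have dbl : 2 * #|SQ| <= #|SA|.
  have := proper_card ne; case/dvdnP: (cardSg sSQ) => m ->.
  by rewrite -{1}[#|SQ|]mul1n ltn_pmul2r // leq_pmul2r.
have le2 : 2 * 'C(k.-1, 3) <= N.
  rewrite -(leq_pmul2r SQ0); apply: leq_trans main.
  by rewrite E4 -mulnA mulnCA leq_mul2l dbl orbT.
by have := @bin3_leq_double k; lia.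
Qed.
End Index.

(** * Extending homomorphisms from M *)

Section Additive.
Local Open Scope ring_scope.
Variables (gT : finGroupType) (V : zmodType).

(** A homomorphism kept as a total function, so that it restricts to subgroups without a change of
    type. *)
Definition additive_on (A : {set gT}) (f : gT -> V) :=
  {in A &, forall g h, f (g * h)%g = f g + f h}.

Variables (G : {group gT}) (f : gT -> V).
Hypothesis addf : additive_on G f.

Lemma add_on1 : f 1%g = 0.
Proof. by apply: (addrI (f 1%g)); rewrite -addf ?group1 // mulg1 addr0. Qed.

Lemma add_onV g : g \in G -> f g^-1%g = - f g.
Proof.
by move=> gG; apply: (addrI (f g)); rewrite -addf ?groupV // mulgV add_on1 subrr.
Qed.

Lemma add_onX g n : g \in G -> f (g ^+ n)%g = f g *+ n.
Proof.
move=> gG; elim: n => [|n IHn]; first by rewrite expg0 mulr0n add_on1.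
by rewrite expgS addf ?groupX // IHn mulrS.
Qed.

Lemma add_on_ker_group_set : group_set [set g in G | f g == 0].
Proof.
apply/group_setP; split=> [|g h]; first by rewrite inE group1 add_on1 eqxx.
rewrite !inE => /andP[gG /eqP g0] /andP[hG /eqP h0].
by rewrite groupM // addf // g0 h0 addr0 eqxx.
Qed.

Canonical add_on_ker := Group add_on_ker_group_set.

End Additive.

Section Cocycle.
Local Open Scope ring_scope.
Variables (gT : finGroupType) (V : zmodType) (X : finType).
Variables (G : {group gT}) (act : gT -> X -> X).
Hypothesis act1 : forall x, act 1%g x = x.
Hypothesis actM : {in G &, forall g h x, act (g * h)%g x = act h (act g x)}.

(** A 1-cocycle with values in the permutation module of functions from [X] to [V], for a right
    action on [X]. *)
Definition cocycle (phi : gT -> X -> V) :=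
  {in G &, forall g h x, phi (g * h)%g x = phi g x + phi h (act g x)}.

(* Shapiro's lemma in degree one. *)
Lemma cocycle_of_stab (Y : {pred X}) x0 (chi : gT -> V) :
  (forall g x, g \in G -> (act g x \in Y) = (x \in Y)) ->
  x0 \in Y -> {in Y, forall y, exists2 t, t \in G & act t x0 = y} ->
  additive_on [set g in G | act g x0 == x0] chi ->
  exists phi, [/\ cocycle phi, forall g, g \in G -> act g x0 = x0 -> phi g x0 = chi g &
    forall g x, x \notin Y -> phi g x = 0].
Proof.
move=> Yact Yx0 tr addchi.
(* A transversal of the stabiliser of [x0]; the default can only occur outside [Y]. *)
pose t y := odflt 1%g [pick t in G | act t x0 == y].
have tG y : t y \in G by rewrite /t; case: pickP => [g /andP[]|_] //=.
have tE y : y \in Y -> act (t y) x0 = y.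
  move=> /tr[g gG gE]; rewrite /t; case: pickP => [h /andP[_ /eqP]//|/(_ g)].
  by rewrite gG gE eqxx.
have stG : group_set [set g in G | act g x0 == x0].
  apply/group_setP; split=> [|g h]; first by rewrite inE group1 act1 eqxx.
  rewrite !inE => /andP[gG /eqP gE] /andP[hG /eqP hE].
  by rewrite groupM // actM // gE hE eqxx.
pose S := Group stG; have addS : additive_on S chi := addchi.
have actK g x : g \in G -> act g^-1%g (act g x) = x.
  by move=> gG; rewrite -actM ?groupV // mulgV act1.
(* The Schreier elements of the transversal, which lie in the stabiliser of [x0]. *)
pose u y g := (t y * g * (t (act g y))^-1)%g.
have uS y g : y \in Y -> g \in G -> u y g \in S.
  move=> yY gG; rewrite inE !groupM ?groupV //=.
  rewrite !actM ?groupM ?groupV // tE //.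
  have := actK (t (act g y)) x0 (tG _); rewrite tE ?Yact // => ->.
  by rewrite eqxx.
exists (fun g y => if y \in Y then chi (u y g) else 0); split; last first.
- by move=> g x /negPf->.
(* The representative [t x0] need not be 1, but it only conjugates [g] inside the stabiliser, and
   [V] is commutative. *)
- move=> g gG gE; rewrite Yx0 /u gE.
  have tS : t x0 \in S by rewrite inE tG tE // eqxx.
  have gS : g \in S by rewrite inE gG gE eqxx.
  rewrite !addS ?groupM ?groupV // (add_onV addS) //.
  by rewrite addrC addKr.
move=> g h gG hG y; rewrite Yact //; case: ifP => yY; last by rewrite addr0.
rewrite -addS ?uS ?Yact //; congr chi.
by rewrite /u actM // !mulgA mulgKV.
Qed.

End Cocycle.

(** * Point stabilisers in a minimal supplement *)

Section Extension.
Local Open Scope ring_scope.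
Variables (gT : finGroupType) (H M : {group gT}) (T : finType).
Variables (pi : {morphism H >-> {perm T}}) (p : nat).
Hypothesis kerE : 'ker pi = M.
Hypothesis imE : (pi @* H)%g = ('Alt_T)%g.
Hypothesis T23 : (22 < #|T|)%N.
Hypothesis frattini : forall K : {group gT}, K \subset H -> (pi @* K)%g = ('Alt_T)%g -> K :=: H.
Local Notation F := 'F_p.
Hypothesis two_neq0 : 2%:R != 0 :> F.
Hypothesis card_neq0 : #|T|%:R != 0 :> F.
Implicit Types (g h v : gT) (D : {set T}) (a b c d w x y z : T) (s : {perm T}).

Let sMH : M \subset H. Proof. by rewrite -kerE subsetIl. Qed.

Lemma pi_ker v : v \in M -> pi v = 1%g.
Proof. by rewrite -kerE => /mker. Qed.

Lemma pi_kerx v x : v \in M -> pi v x = x.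
Proof. by move/pi_ker->; rewrite perm1. Qed.

Lemma inH v : v \in M -> v \in H. Proof. exact: (subsetP sMH). Qed.

Lemma piM g h x : g \in H -> h \in H -> pi (g * h)%g x = pi h (pi g x).
Proof. by move=> gH hH; rewrite morphM // permM. Qed.

Lemma pi1 x : pi 1%g x = x. Proof. by rewrite morph1 perm1. Qed.

Lemma pi_eqM g h : g \in H -> h \in H -> pi g = pi h -> (g * h^-1)%g \in M.
Proof.
move=> gH hH E; rewrite -kerE; apply/kerP; first by rewrite groupM ?groupV.
by rewrite morphM ?groupV // morphV // E mulgV.
Qed.

Lemma pi_lift s : s \in ('Alt_T)%g -> exists2 h, h \in H & pi h = s.
Proof. by rewrite -imE => /morphimP[h _ hH ->]; exists h. Qed.

Lemma pi_alt h : h \in H -> pi h \in ('Alt_T)%g.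
Proof. by move=> hH; rewrite -imE mem_morphim. Qed.

Definition pt_stab_set D := [set h in H | [forall x in D, pi h x == x]].

Lemma pt_stabP D h :
  reflect (h \in H /\ {in D, forall x, pi h x = x}) (h \in pt_stab_set D).
Proof.
rewrite inE; apply: (iffP andP) => -[hH hD]; split=> //.
  by move=> x xD; apply/eqP; apply: (forall_inP hD).
by apply/forall_inP=> x xD; rewrite hD.
Qed.

Lemma pt_stab_group_set D : group_set (pt_stab_set D).
Proof.
apply/group_setP; split=> [|g h].
  by apply/pt_stabP; split=> [|x _]; rewrite ?group1 ?pi1.
move=> /pt_stabP[gH gD] /pt_stabP[hH hD]; apply/pt_stabP; split=> [|x xD].
  exact: groupM.
by rewrite piM // gD ?hD.
Qed.

Canonical pt_stab D := Group (pt_stab_group_set D).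

Lemma pt_stab_sub D : pt_stab D \subset H.
Proof. by apply/subsetP=> h /pt_stabP[]. Qed.

Lemma pt_stab_subM D : M \subset pt_stab D.
Proof. by apply/subsetP=> v vM; apply/pt_stabP; split=> [|x _]; rewrite ?inH ?pi_kerx. Qed.

Lemma pt_stabS D D' : D \subset D' -> pt_stab D' \subset pt_stab D.
Proof.
move=> sDD'; apply/subsetP=> h /pt_stabP[hH hD']; apply/pt_stabP; split=> // x xD.
by apply: hD'; apply: (subsetP sDD').
Qed.

Lemma pt_stab0 : pt_stab set0 = H.
Proof.
apply/group_inj/setP=> h; apply/pt_stabP/idP=> [[]//|hH].
by split=> // x; rewrite inE.
Qed.

Lemma pt_stabU1 D y h :
  reflect (h \in pt_stab D /\ pi h y = y) (h \in pt_stab (y |: D)).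
Proof.
apply: (iffP idP) => [/pt_stabP[hH hD]|[/pt_stabP[hH hD] hy]].
  split; last by apply: hD; rewrite setU11.
  by apply/pt_stabP; split=> // x xD; apply: hD; rewrite setU1r.
by apply/pt_stabP; split=> // x /setU1P[->|/hD].
Qed.

(** Apply [alt_move] to the points of [D] followed by [t], respectively by [u]. *)
Lemma pt_stab_move D (t u : seq T) :
  uniq t -> uniq u -> {in t, forall x, x \notin D} -> {in u, forall x, x \notin D} ->
  size t = size u -> (#|D| + size t + 2 <= #|T|)%N ->
  exists2 h, h \in pt_stab D & map (pi h) t = u.
Proof.
move=> Ut Uu tD uD szE le_t.
have cat_uniq' r : uniq r -> {in r, forall x, x \notin D} -> uniq (enum D ++ r).
  move=> Ur rD; rewrite cat_uniq enum_uniq Ur andbT; apply/hasPn=> x /rD.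
  by rewrite /= mem_enum.
have [||||s As sE] := @alt_move T (enum D ++ t) (enum D ++ u).
- exact: cat_uniq'.
- exact: cat_uniq'.
- by rewrite !size_cat szE.
- by rewrite size_cat -cardE.
have [h hH hE] := pi_lift As; exists h.
  apply/pt_stabP; split=> // x xD; rewrite hE; move/eqP: sE.
  rewrite map_cat eqseq_cat ?size_map // => /andP[/eqP sE _].
  rewrite -mem_enum in xD; have ixD : (index x (enum D) < size (enum D))%N by rewrite index_mem.
  by have := nth_map x x s ixD; rewrite sE !nth_index // => <-.
move/eqP: sE; rewrite map_cat eqseq_cat ?size_map // => /andP[_ /eqP <-].
by rewrite hE.
Qed.

(* A 3-cycle is a product of two involutions, and F has no 2-torsion. *)
Lemma add_on_trivial D (chi : gT -> F) : (#|D| + 5 <= #|T|)%N ->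
  additive_on (pt_stab D) chi -> {in M, forall v, chi v = 0} ->
  {in pt_stab D, forall h, chi h = 0}.
Proof.
move=> leD addchi chiM; pose K := add_on_ker addchi.
have sMK : M \subset K.
  by apply/subsetP=> v vM; rewrite inE (subsetP (pt_stab_subM D)) // chiM.
have sKD : K \subset pt_stab D by apply/subsetP=> h; rewrite inE => /andP[].
have sKH := subset_trans sKD (pt_stab_sub D).
(* A lift [h] of [s] has its square in [M], so [2 * chi h = 0] and [h] lies in the kernel [K]. *)
have invo s : s \in ('Alt_T)%g -> {in D, forall x, s x = x} -> (s * s)%g = 1%g ->
    s \in (pi @* K)%g.
  move=> As sD ss; have [h hH hE] := pi_lift As.
  have hS : h \in pt_stab D by apply/pt_stabP; split=> // x xD; rewrite hE sD.
  have hhM : (h * h)%g \in M.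
    by rewrite -kerE; apply/kerP; rewrite ?groupM // morphM // hE.
  rewrite -hE mem_morphim // inE hS.
  move: (chiM _ hhM); rewrite addchi // -mulr2n -mulr_natr => /eqP.
  by rewrite mulf_eq0 (negPf two_neq0) orbF.
have tcK a b c : uniq [:: a; b; c] -> a \in ~: D -> b \in ~: D -> c \in ~: D ->
    tc a b c \in (pi @* K)%g.
  rewrite /= !inE negb_or andbT -andbA => /and3P[ab ac bc] aD bD cD.
  pose E := D :|: [set a; b; c].
  have cE : (#|E| <= #|D| + 3)%N.
    apply: leq_trans (leq_card_setU _ _) _; rewrite leq_add2l.
    by rewrite -setUA cardsU1 cards2; case: (_ \notin _); case: (_ != _).
  (* Two spare points outside [D] and the 3-cycle: the factor [tperm d e] makes both involutions
     even. *)
  have /card_gt1P[d [e [dE eE de]]] : (1 < #|~: E|)%N.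
    rewrite -(leq_add2l #|E|) cardsC (leq_trans _ leD) //.
    by rewrite (leq_trans (leq_add cE (leqnn 2))) // -addnA.
  move: dE eE; rewrite !inE !negb_or -!andbA => /and4P[dD da db dc] /and4P[eD ea eb ec].
  have tpC (w x y z : T) : w != y -> w != z -> x != y -> x != z ->
      commute (tperm w x) (tperm y z).
    move=> wy wz xy xz; apply: (perm_onC (S1 := [set w; x]) (S2 := [set y; z])).
    - exact: tperm_on.
    - exact: tperm_on.
    - rewrite -setI_eq0; apply/eqP/setP=> u; rewrite !inE; apply/negP.
      case/andP=> /orP[]/eqP-> /orP[]/eqP E0.
      + by rewrite E0 eqxx in wy.
      + by rewrite E0 eqxx in wz.
      + by rewrite E0 eqxx in xy.
      + by rewrite E0 eqxx in xz.
  have -> : tc a b c = ((tperm a b * tperm d e) * (tperm d e * tperm a c))%g.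
    by rewrite -!mulgA (mulgA (tperm d e)) tperm2 mul1g.
  have invol w x y z : w != x -> y != z -> w != y -> w != z -> x != y -> x != z ->
      w \notin D -> x \notin D -> y \notin D -> z \notin D ->
      (tperm w x * tperm y z)%g \in (pi @* K)%g.
    move=> wx yz wy wz xy xz wD xD yD zD; apply: invo.
    - by rewrite Alt_even odd_permM !odd_tperm wx yz.
    - move=> u uD; rewrite permM !tpermD //; apply: contraTneq uD => <- //.
    - by rewrite -mulgA (mulgA (tperm y z)) -(tpC w x y z) // -mulgA tperm2 mulg1 tperm2.
  by rewrite groupM // invol // eq_sym.
move=> h hS; have /morphimP[k _ kK hk] : pi h \in (pi @* K)%g.
  apply: (alt_on_sub (O := ~: D) tcK).
    by apply: pi_alt; case/pt_stabP: hS.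
  apply/subsetP=> x; rewrite !inE; apply: contraNN => xD.
  by case/pt_stabP: hS => _ ->.
have hM : (h * k^-1)%g \in M.
  by apply: pi_eqM => //; [case/pt_stabP: hS | apply: (subsetP sKH)].
have kD := subsetP sKD _ kK.
have := chiM _ hM; rewrite addchi ?groupV // (add_onV addchi) //.
by move: kK; rewrite inE => /andP[_ /eqP->]; rewrite subr0.
Qed.

Lemma Fp_mulrn (c a : F) : c != 0 -> exists n, c *+ n = a.
Proof.
by move=> c0; exists (a / c : F); rewrite -mulr_natr natr_Zp mulrC divfK.
Qed.

(** If [chi v] were nonzero, powers of [v] would correct any [h] into the kernel of [chi], a proper
    subgroup mapping onto ['Alt_T]. *)
Lemma add_on_H_trivial (chi : gT -> F) : additive_on H chi -> {in M, forall v, chi v = 0}.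
Proof.
move=> addchi v vM; have vH := inH vM; apply/eqP; apply/negPn/negP=> c0.
pose K := add_on_ker addchi.
have sKH : K \subset H by apply/subsetP=> h; rewrite inE => /andP[].
have KE : (pi @* K)%g = ('Alt_T)%g.
  apply/eqP; rewrite eqEsubset -{1}imE morphimS //=; apply/subsetP=> s /pi_lift[h hH <-].
  have [n nE] := Fp_mulrn (- chi h) c0.
  have hvK : (h * v ^+ n)%g \in K.
    by rewrite inE groupM ?groupX // addchi ?groupX // (add_onX addchi) // nE addrN eqxx.
  by have := mem_morphim pi (subsetP sKH _ hvK) hvK; rewrite morphM ?groupX // (pi_ker (groupX n vM)) mulg1.
have : v \in K by rewrite (frattini sKH KE) inH.
by rewrite inE (negPf c0) andbF.
Qed.

(** * The space of functions that a cocycle attains on M *)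

Section Supplement.
Variables (X : finType) (act : gT -> X -> X) (phi : gT -> X -> F).
Hypothesis act_ker : {in M, forall v (x : X), act v x = x}.
Hypothesis cphi : cocycle H act phi.

Lemma cocycle1 (x : X) : phi 1%g x = 0.
Proof.
by apply: (addrI (phi 1%g x)); rewrite addr0 -{2}(act_ker (group1 M) x) -cphi // mulg1.
Qed.

Lemma cocycleV v (x : X) : v \in M -> phi v^-1%g x = - phi v x.
Proof.
move=> vM; apply: (addrI (phi v x)); rewrite -{2}(act_ker vM x) -cphi ?groupV ?inH //.
by rewrite mulgV cocycle1 subrr.
Qed.

(** Under the hypothesis every [h] is a product of some [v] in [M] and a zero of [phi], so the
    subgroup of zeros maps onto ['Alt_T] and is [H]. *)
Lemma supplement_cocycle :
  {in H, forall h, exists2 v, v \in M & forall x : X, phi v x = phi h x} ->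
  {in M, forall v (x : X), phi v x = 0}.
Proof.
move=> sup; pose K0 := [set h in H | [forall x, phi h x == 0]].
have K0P h : reflect (h \in H /\ forall x : X, phi h x = 0) (h \in K0).
  rewrite inE; apply: (iffP andP) => -[hH h0]; split=> //.
    by move=> x; apply/eqP; apply: (forallP h0).
  by apply/forallP=> x; rewrite h0.
have gK0 : group_set K0.
  apply/group_setP; split=> [|g h /K0P[gH g0] /K0P[hH h0]].
    by apply/K0P; split=> // x; apply: cocycle1.
  by apply/K0P; split=> [|x]; rewrite ?groupM // cphi // g0 h0 addr0.
pose K := Group gK0; have sKH : K \subset H by apply/subsetP=> h /K0P[].
have KE : (pi @* K)%g = ('Alt_T)%g.
  apply/eqP; rewrite eqEsubset -{1}imE morphimS //=; apply/subsetP=> s /pi_lift[h hH <-].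
  have [v vM vE] := sup h hH; have vH := inH vM.
  have vhK : (v^-1 * h)%g \in K.
    apply/K0P; split=> [|x]; first by rewrite groupM ?groupV.
    by rewrite cphi ?groupV // cocycleV // act_ker ?groupV // vE addNr.
  have := mem_morphim pi (subsetP sKH _ vhK) vhK.
  by rewrite morphM ?groupV // (pi_ker (groupVr vM)) mul1g.
by move=> v vM x; have /K0P[_ ->] : v \in K by rewrite (frattini sKH KE) inH.
Qed.

(** As [M] acts trivially on [X], these functions form a subspace over [F], stable under [H]. *)
Definition realised (f : X -> F) := exists2 v, v \in M & forall x : X, phi v x = f x.

Lemma realised_ext (f f' : X -> F) : (forall x : X, f x = f' x) -> realised f -> realised f'.
Proof. by move=> E [v vM vE]; exists v => // x; rewrite vE. Qed.

Lemma realisedD (f f' : X -> F) :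
  realised f -> realised f' -> realised (fun x : X => f x + f' x).
Proof.
move=> [v vM vE] [v' v'M v'E]; exists (v * v')%g; first exact: groupM.
by move=> x; rewrite cphi ?inH // act_ker // vE v'E.
Qed.

Lemma realised0 : realised (fun=> 0).
Proof. by exists 1%g; [exact: group1 | exact: cocycle1]. Qed.

Lemma realised_sum (I : Type) (r : seq I) (P : pred I) (f : I -> X -> F) :
  (forall i, P i -> realised (f i)) -> realised (fun x : X => \sum_(i <- r | P i) f i x).
Proof.
move=> Rf; elim: r => [|i r IHr].
  by apply: realised_ext realised0 => x; rewrite big_nil.
case Pi: (P i); last by apply: realised_ext IHr => x; rewrite big_cons Pi.
by apply: realised_ext (realisedD (Rf i Pi) IHr) => x; rewrite big_cons Pi.
Qed.

(** A scalar of the prime field is a natural number, so this is a repeated sum. *)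
Lemma realisedZ (k : F) (f : X -> F) : realised f -> realised (fun x : X => k * f x).
Proof.
move=> Rf; have := @realised_sum _ (iota 0 k) xpredT (fun _ => f) (fun _ _ => Rf).
apply: realised_ext => x; rewrite big_const_seq iter_addr_0 count_predT size_iota.
by rewrite -{2}[k]natr_Zp mulr_natl.
Qed.

Lemma realisedB (f f' : X -> F) :
  realised f -> realised f' -> realised (fun x : X => f x - f' x).
Proof.
move=> Rf Rf'; apply: realised_ext (realisedD Rf (realisedZ (-1) Rf')) => x.
by rewrite mulN1r.
Qed.

(** Expand [phi] on both sides of [v ^ h^-1 * h = h * v]. *)
Lemma cocycle_conjH h v (x : X) : h \in H -> v \in M -> phi (v ^ h^-1)%g x = phi v (act h x).
Proof.
move=> hH vM; have vH := inH vM.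
have vhM : (v ^ h^-1)%g \in M by rewrite memJ_norm // -kerE (subsetP (ker_norm pi)) ?groupV.
have E : (v ^ h^-1 * h = h * v)%g by rewrite conjgE invgK -!mulgA mulVg mulg1.
apply: (addrI (phi h x)); rewrite -(cphi hH vH) -E (cphi (inH vhM) hH).
by rewrite act_ker // addrC.
Qed.

Lemma realised_act h (f : X -> F) : h \in H -> realised f -> realised (fun x : X => f (act h x)).
Proof.
move=> hH [v vM vE]; exists (v ^ h^-1)%g.
  by rewrite memJ_norm // -kerE (subsetP (ker_norm pi)) ?groupV.
by move=> x; rewrite cocycle_conjH.
Qed.

End Supplement.

(** * Cocycles on points *)

Definition pact g x := pi g x.

Lemma cocycle_conj (D : {set T}) (phi : gT -> T -> F) t v x :
  cocycle (pt_stab D) pact phi -> t \in pt_stab D -> v \in M ->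
  phi v (pi t x) = phi (v ^ t^-1)%g x.
Proof.
move=> cphi tD vM; have vD := subsetP (pt_stab_subM D) v vM.
have vtD : (v ^ t^-1)%g \in pt_stab D by rewrite groupJ ?groupV.
have tH := subsetP (pt_stab_sub D) t tD.
have vtM : (v ^ t^-1)%g \in M by rewrite memJ_norm // -kerE (subsetP (ker_norm pi)) ?groupV.
have E : (v ^ t^-1 * t = t * v)%g by rewrite conjgE invgK -!mulgA mulVg mulg1.
have := cphi _ _ tD vD x; have := cphi _ _ vtD tD x.
by rewrite /pact (pi_kerx x vtM) E => -> E2; apply: (addrI (phi t x)); rewrite -E2 addrC.
Qed.

(* In cohomological terms: a class in H^2(Alt_n, F) which vanishes on a point
   stabiliser is zero.  If g fixes w and maps a to b, then phi g a - phi g w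
   depends on a and b only, and this gives the coboundary to subtract. *)
Lemma extend_invariant D y (chi : gT -> F) :
  y \notin D -> (#|D| + 9 <= #|T|)%N ->
  additive_on (pt_stab (y |: D)) chi ->
  {in pt_stab D & M, forall h v, chi (v ^ h)%g = chi v} ->
  exists chi' : gT -> F, additive_on (pt_stab D) chi' /\ {in M, chi' =1 chi}.
Proof.
move=> yD leD addchi inv.
have sDH := pt_stab_sub D; have sMD := pt_stab_subM D.
have leDn n : (n <= 9)%N -> (#|D| + n <= #|T|)%N.
  by move=> n9; apply: leq_trans leD; rewrite leq_add2l.
have fresh (r : seq T) : (size r <= 6)%N -> exists2 w, w \notin D & w \notin r.
  move=> r6; case: (pickP [pred w | (w \notin D) && (w \notin r)]) => [w /andP[]|none].
    by exists w.
  have TE : D :|: [set x in r] = setT.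
    apply/setP=> w; rewrite !inE; have := none w.
    by rewrite /=; case: (w \in D); case: (w \in r).
  have := leq_card_setU D [set x in r]; rewrite TE cardsT cardsE => -[le _].
  have := leq_trans le (leq_add (leqnn _) (leq_trans (card_size _) r6)).
  by move/(leq_trans leD); rewrite leq_add2l.
have stabD g x : g \in pt_stab D -> (pi g x \notin D) = (x \notin D).
  move=> gD; congr (~~ _); apply/idP/idP=> xD; last first.
    by case/pt_stabP: gD => _ ->.
  suffices <- : pi g x = x by [].
  by apply: (@perm_inj _ (pi g)); case/pt_stabP: gD => _ ->.
have move1 a b : a \notin D -> b \notin D -> exists2 t, t \in pt_stab D & pi t a = b.
  move=> aD bD; have [||||||t tD [tE]] := @pt_stab_move D [:: a] [:: b] => //.
  - by move=> x; rewrite inE => /eqP->.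
  - by move=> x; rewrite inE => /eqP->.
  - by rewrite -addnA leDn.
  by exists t.
have move2 w a b : w \notin D -> a \notin D -> b \notin D -> a != w -> b != w ->
    exists2 t, t \in pt_stab (w |: D) & pi t a = b.
  move=> wD aD bD aw bw.
  have [||||||t tD [tw tE]] := @pt_stab_move D [:: w; a] [:: w; b] => //.
  - by rewrite /= inE eq_sym aw.
  - by rewrite /= inE eq_sym bw.
  - by move=> x; rewrite !inE => /orP[]/eqP->.
  - by move=> x; rewrite !inE => /orP[]/eqP->.
  - by rewrite -addnA leDn.
  by exists t => //; apply/pt_stabU1.
have [phi [cphi phiy _]] : exists phi : gT -> T -> F, [/\ cocycle (pt_stab D) pact phi,
    forall g, g \in pt_stab D -> pact g y = y -> phi g y = chi g &
    forall g x, x \notin [pred x | x \notin D] -> phi g x = 0].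
  apply: cocycle_of_stab => //.
  - by move=> x; apply: pi1.
  - by move=> g h gD hD x; apply: piM; apply: (subsetP sDH).
  - by move=> x; rewrite inE => xD; apply: move1.
  move=> g h gD hD; apply: addchi; first by apply/pt_stabU1; move: gD; rewrite inE => /andP[? /eqP].
  by apply/pt_stabU1; move: hD; rewrite inE => /andP[? /eqP].
(* Invariance of [chi] makes the induced cocycle constant off [D] for elements of [M]. *)
have phiM v x : v \in M -> x \notin D -> phi v x = chi v.
  move=> vM xD; have [t tD <-] := move1 y x yD xD.
  have tH := subsetP sDH t tD.
  have vtM : (v ^ t^-1)%g \in M by rewrite memJ_norm // -kerE (subsetP (ker_norm pi)) ?groupV.
  rewrite (cocycle_conj _ cphi) // phiy ?(subsetP sMD) ?inv ?groupV //.
  by rewrite /pact pi_kerx.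
have phiP g h x : g \in pt_stab D -> h \in pt_stab D ->
    phi (g * h)%g x = phi g x + phi h (pi g x) by move=> gD hD; apply: cphi.
(* The difference of the two sides is a homomorphism vanishing on [M], so [add_on_trivial] kills
   it. *)
have claim1 w w' h : w \notin D -> w' \notin D -> h \in pt_stab (w |: (w' |: D)) ->
    phi h w = phi h w'.
  move=> wD w'D hS; apply/eqP; rewrite -subr_eq0; apply/eqP.
  have sW := subset_trans (pt_stabS (subsetUr [set w] _)) (pt_stabS (subsetUr [set w'] D)).
  apply: (add_on_trivial (D := w |: (w' |: D)) (chi := fun h => phi h w - phi h w')) hS.
  - apply: leq_trans (leDn 7 isT); rewrite -[7]/(2 + 5)%N addnA leq_add2r.
    by rewrite !cardsU1 addnA addnC leq_add2l; case: (_ \notin _); case: (_ \notin _).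
  - move=> g k gS kS; rewrite /= !phiP ?(subsetP sW) //.
    move: gS => /pt_stabU1[/pt_stabU1[_ ->] ->].
    ring.
  - by move=> v vM; rewrite /= !phiM // subrr.
(* Any other choice of [g] differs by an element fixing [w] and [a], so [claim1] makes the value
   independent of it; the default occurs only if there is no such [g]. *)
pose c w a b := let g := odflt 1%g [pick g in pt_stab (w |: D) | pi g a == b] in phi g a - phi g w.
have cE w g a : w \notin D -> a \notin D -> a != w -> g \in pt_stab (w |: D) ->
    c w a (pi g a) = phi g a - phi g w.
  move=> wD aD aw gS; rewrite /c; case: pickP => [k /andP[kS /eqP kE]|/(_ g)]; last by rewrite gS eqxx.
  have gD := subsetP (pt_stabS (subsetUr [set w] D)) g gS.
  have kD := subsetP (pt_stabS (subsetUr [set w] D)) k kS.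
  have kgS : (k * g^-1)%g \in pt_stab (a |: (w |: D)).
    apply/pt_stabU1; split; first by rewrite groupM ?groupV.
    rewrite piM ?groupV ?(subsetP sDH) // kE -piM ?groupV ?(subsetP sDH) //.
    by rewrite mulgV pi1.
  have kgD : (k * g^-1)%g \in pt_stab D by rewrite groupM ?groupV.
  rewrite /= -(mulgKV g k); move: (k * g^-1)%g kgS kgD => kg kgS kgD.
  rewrite !phiP //; have /pt_stabU1[/pt_stabU1[_ ->] ->] := kgS.
  rewrite (claim1 _ _ _ aD wD kgS); ring.
have claim3 w w' a b : w \notin D -> w' \notin D -> a \notin D -> b \notin D ->
    a != w -> b != w -> a != w' -> b != w' -> c w a b = c w' a b.
  move=> wD w'D aD bD aw bw aw' bw'; have [->//|ww'] := eqVneq w w'.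
  have [||||||t tD [tw tw' tE]] := @pt_stab_move D [:: w; w'; a] [:: w; w'; b] => //.
  - by rewrite /= !inE !negb_or ww' !(eq_sym _ a) aw aw'.
  - by rewrite /= !inE !negb_or ww' !(eq_sym _ b) bw bw'.
  - by move=> x; rewrite !inE => /or3P[]/eqP->.
  - by move=> x; rewrite !inE => /or3P[]/eqP->.
  - by rewrite -addnA leDn.
  have t1 : t \in pt_stab (w |: D) by apply/pt_stabU1.
  have t2 : t \in pt_stab (w' |: D) by apply/pt_stabU1.
  rewrite -tE !cE // (claim1 w w') //.
  by apply/pt_stabU1.
(* This additivity makes [c w] the coboundary of [c w y], a function of one point. *)
have claim4 w a b d : w \notin D -> a \notin D -> b \notin D -> d \notin D ->
    a != w -> b != w -> d != w -> c w a b + c w b d = c w a d.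
  move=> wD aD bD dD aw bw dw.
  have [g gS gE] := move2 w a b wD aD bD aw bw.
  have [h hS hE] := move2 w b d wD bD dD bw dw.
  have sS := subsetP (pt_stabS (subsetUr [set w] D)).
  have ghE : pi (g * h)%g a = d by rewrite piM ?(subsetP sDH) ?sS // gE.
  have ghS : (g * h)%g \in pt_stab (w |: D) by apply: groupM.
  have := cE w _ _ wD aD aw ghS; rewrite ghE => ->.
  have := cE w _ _ wD aD aw gS; rewrite gE => ->.
  have := cE w _ _ wD bD bw hS; rewrite hE => ->.
  rewrite !phiP ?sS // gE; have /pt_stabU1[_ ->] := gS; ring.
(* A base point off [y] and [a], which always exists; by [claim3] its choice does not affect [b]. *)
pose wit a := odflt a [pick w | [&& w \notin D, w != y & w != a]].
have witP a : [/\ wit a \notin D, wit a != y & wit a != a].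
  rewrite /wit; case: pickP => [w /and3P[]//|none].
  have [w wD] := fresh [:: y; a] isT; rewrite !inE negb_or => /andP[wy wa].
  by have := none w; rewrite wD wy wa.
pose b a := c (wit a) y a.
have bE w a : w \notin D -> a \notin D -> w != y -> w != a -> b a = c w y a.
  move=> wD aD wy wa; have [w1 w2 w3] := witP a.
  by apply: claim3; rewrite // eq_sym.
have fixE u h x : u \notin D -> x \notin D -> h \in pt_stab (u |: D) ->
    phi h x - phi h u = b (pi h x) - b x.
  move=> uD xD hS; have hD := subsetP (pt_stabS (subsetUr [set u] D)) h hS.
  have /pt_stabU1[_ hu] := hS.
  have [->|xu] := eqVneq x u; first by rewrite hu !subrr.
  have hxD : pi h x \notin D by rewrite stabD.
  have hxu : pi h x != u by rewrite -hu (inj_eq perm_inj).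
  (* The base point [u] may be [y], where [bE] does not apply, so it is exchanged for a fresh
     one. *)
  have [w wD] := fresh [:: y; x; pi h x; u] isT.
  rewrite !inE !negb_or => /and4P[wy wx whx wu].
  rewrite (bE w) // (bE w x) // -cE // (claim3 u w) //; last 2 first.
  - by rewrite eq_sym.
  - by rewrite eq_sym.
  by rewrite -(claim4 w y x (pi h x)) 1?eq_sym //; ring.
have const h x x' : h \in pt_stab D -> x \notin D -> x' \notin D ->
    phi h x - (b (pi h x) - b x) = phi h x' - (b (pi h x') - b x').
  have fix1 u k z : u \notin D -> z \notin D -> k \in pt_stab (u |: D) ->
      phi k z - (b (pi k z) - b z) = phi k u.
    by move=> uD zD kS; rewrite -(fixE u k z) //; ring.
  move=> hD xD x'D; have [w wD] := fresh [:: x; pi h x] isT.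
  rewrite !inE negb_or => /andP[wx whx].
  have hxD : pi h x \notin D by rewrite stabD.
  (* Factor [h] as [k * g] with [k] fixing [x] and [g] fixing [w]; the claim is known for each
     factor. *)
  have [||g gS gE] := move2 w x (pi h x) wD xD hxD; rewrite 1?eq_sym //.
  have gD := subsetP (pt_stabS (subsetUr [set w] D)) g gS.
  have kD : (h * g^-1)%g \in pt_stab D by rewrite groupM ?groupV.
  have kS : (h * g^-1)%g \in pt_stab (x |: D).
    apply/pt_stabU1; split=> //.
    rewrite piM ?groupV ?(subsetP sDH) // -gE -piM ?groupV ?(subsetP sDH) //.
    by rewrite mulgV pi1.
  rewrite -(mulgKV g h); move: (h * g^-1)%g kD kS => k kD kS.
  have E z : z \notin D -> phi (k * g)%g z - (b (pi (k * g)%g z) - b z) = phi k x + phi g w.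
    move=> zD; have kzD : pi k z \notin D by rewrite stabD.
    rewrite phiP // piM ?(subsetP sDH) //.
    rewrite -(fix1 x k z) // -(fix1 w g (pi k z)) //; ring.
  by rewrite !E.
(* A cocycle with constant values is a homomorphism. *)
exists (fun h => phi h y - (b (pi h y) - b y)); split=> [g h gD hD | v vM] /=; last first.
  by rewrite pi_kerx // subrr subr0 phiM.
have gyD : pi g y \notin D by rewrite stabD.
rewrite (const h y (pi g y)) // phiP // piM ?(subsetP sDH) //; ring.
Qed.

Lemma pact_ker : {in M, forall v x, pact v x = x}.
Proof. by move=> v vM x; apply: pi_kerx. Qed.

Lemma fresh_seq (r : seq T) n : uniq r -> (size r + n <= #|T|)%N ->
  exists2 t : seq T, size t = n & uniq (r ++ t).
Proof.
move=> Ur le; exists (take n [seq x <- enum T | x \notin r]); last first.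
  rewrite cat_uniq Ur (take_uniq _ (filter_uniq _ (enum_uniq _))) andbT /=.
  by apply/hasPn=> x /mem_take; rewrite mem_filter => /andP[].
apply: size_takel; rewrite size_filter -(leq_add2l (size r)); apply: leq_trans le _.
rewrite cardT -(count_predC [in r] (enum T)) leq_add2r -size_filter.
apply: uniq_leq_size; first by rewrite filter_uniq ?enum_uniq.
by move=> x; rewrite mem_filter => /andP[].
Qed.

Lemma tperm2_alt x y z w : x != y -> z != w -> (tperm x y * tperm z w)%g \in ('Alt_T)%g.
Proof. by move=> xy zw; rewrite Alt_even odd_permM !odd_tperm xy zw. Qed.

Lemma realised_pact (phi : gT -> T -> F) (f : T -> F) s : cocycle H pact phi ->
  s \in ('Alt_T)%g -> realised phi f -> realised phi (fun x => f (s x)).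
Proof. by move=> cphi /pi_lift[h hH <-] Rf; apply: (realised_act pact_ker cphi hH Rf). Qed.

Ltac split_uniq U :=
  rewrite /= ?inE ?negb_or ?andbT -?andbA in U; repeat (case/andP: U => ? U).

Ltac decide_eqs :=
  repeat match goal with
  | |- context [?u == ?u] => rewrite (eqxx u)
  | E : is_true (?u != ?v) |- context [?u == ?v] => rewrite (negPf E)
  | E : is_true (?u != ?v) |- context [?v == ?u] => rewrite [v == u]eq_sym (negPf E)
  end.

(* The combination of [f] and its translates by even permutations used here
   agrees with [2 (1 - (w w'))]. *)
Lemma realised_delta (phi : gT -> T -> F) (f : T -> F) w w' : cocycle H pact phi ->
  realised phi f -> w != w' -> f w != f w' ->
  realised phi (fun x => (x == w)%:R - (x == w')%:R).
Proof.
move=> cphi Rf ww' fww'.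
have [||t szt U] := @fresh_seq [:: w; w'] 4; first by rewrite /= inE ww'.
  by rewrite (leq_trans _ T23).
case: t szt U => [|a [|b [|c [|d [|]]]]] //= _ U.
split_uniq U.
pose g x := f x + f ((tperm a b * tperm c d)%g x)
   - f ((tperm w w' * tperm a b)%g x) - f ((tperm w w' * tperm c d)%g x).
have Rg : realised phi g.
  have R s : s \in ('Alt_T)%g -> realised phi (fun x => f (s x)).
    by move=> As; apply: realised_pact.
  apply: (realisedB pact_ker cphi); last by apply/R/tperm2_alt.
  apply: (realisedB pact_ker cphi); last by apply/R/tperm2_alt.
  by apply: (realisedD pact_ker cphi) => //; apply/R/tperm2_alt.
(* This is the value of [g] at [w]; at [w'] it is the opposite, and elsewhere [g] vanishes. *)
have c0 : 2%:R * (f w - f w') != 0 by rewrite mulf_neq0 // subr_eq0.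
apply: realised_ext (realisedZ pact_ker cphi (2%:R * (f w - f w'))^-1 Rg) => x.
apply: (canLR (mulKf c0)); rewrite /g !permM !permE /=.
have [->|xw] := eqVneq x w; first by decide_eqs; rewrite /= ?permE /=; decide_eqs; ring.
have [->|xw'] := eqVneq x w'; first by decide_eqs; rewrite /= ?permE /=; decide_eqs; ring.
have [->|xa] := eqVneq x a; first by decide_eqs; rewrite /= ?permE /=; decide_eqs; ring.
have [->|xb] := eqVneq x b; first by decide_eqs; rewrite /= ?permE /=; decide_eqs; ring.
have [->|xc] := eqVneq x c; first by decide_eqs; rewrite /= ?permE /=; decide_eqs; ring.
have [->|xd] := eqVneq x d; first by decide_eqs; rewrite /= ?permE /=; decide_eqs; ring.
by decide_eqs; rewrite /= ?permE /=; decide_eqs; ring.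
Qed.

Lemma pt_stab1P x h : reflect (h \in H /\ pi h x = x) (h \in pt_stab [set x]).
Proof.
apply: (iffP (pt_stabP _ _)) => -[hH hx]; split=> //; first by apply: hx; rewrite set11.
by move=> y /set1P->.
Qed.

Lemma leq_card n : (n <= 23)%N -> (n <= #|T|)%N.
Proof. by move=> n23; apply: leq_trans n23 T23. Qed.

Lemma alt_trans1 x y : exists2 h, h \in H & pi h x = y.
Proof.
have [||||s As [sE]] := @alt_move T [:: x] [:: y] => //; first exact: leq_card.
by have [h hH hE] := pi_lift As; exists h; rewrite // hE.
Qed.

Lemma add_on_H_zero (chi : gT -> F) : additive_on H chi -> {in H, forall h, chi h = 0}.
Proof.
move=> addchi; have add0 : additive_on (pt_stab set0) chi by rewrite pt_stab0.
move=> h hH; apply: (add_on_trivial (D := set0) _ add0); last by rewrite pt_stab0.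
  by rewrite cards0 leq_card.
exact: add_on_H_trivial.
Qed.

Lemma point_hom_trivial x (chi : gT -> F) : additive_on (pt_stab [set x]) chi ->
  {in M, forall v, chi v = 0}.
Proof.
move=> addchi.
have [phi [cphi phix _]] : exists phi : gT -> T -> F, [/\ cocycle H pact phi,
    forall g, g \in H -> pact g x = x -> phi g x = chi g &
    forall g y, y \notin predT -> phi g y = 0].
  apply: cocycle_of_stab => //.
  - by move=> y; apply: pi1.
  - by move=> g h gH hH y; apply: piM.
  - by move=> y _; apply: alt_trans1.
  move=> g h gS hS; apply: addchi; apply/pt_stab1P.
    by move: gS; rewrite inE => /andP[? /eqP].
  by move: hS; rewrite inE => /andP[? /eqP].
have phiM v : v \in M -> phi v x = chi v by move=> vM; rewrite phix ?inH // /pact pi_kerx.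
(* Summing over all points turns the cocycle into a homomorphism on [H]. *)
have sum0 : {in H, forall h, \sum_w phi h w = 0}.
  apply: add_on_H_zero => g h gH hH.
  under eq_bigr do rewrite cphi //.
  rewrite big_split /=; congr (_ + _).
  by rewrite [RHS](reindex_inj (@perm_inj _ (pi g))).
case: (boolP [forall v in M, forall w, forall w', phi v w == phi v w']) => [const|].
  have [||||chi' [addchi' chi'E]] := @extend_invariant set0 x chi.
  - by rewrite inE.
  - by rewrite cards0 leq_card.
  - by rewrite setU0.
  - rewrite pt_stab0 => h v hH vM; have vhM : (v ^ h)%g \in M.
      by rewrite memJ_norm // -kerE (subsetP (ker_norm pi)).
    have cphi0 : cocycle (pt_stab set0) pact phi by rewrite pt_stab0.
    have := cocycle_conj (t := h^-1%g) x cphi0; rewrite pt_stab0 groupV => /(_ v hH vM).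
    rewrite invgK -phiM // -phiM // => <-; apply/eqP.
    by have /forall_inP/(_ v vM)/forallP/(_ (pi h^-1%g x))/forallP/(_ x) := const.
  rewrite pt_stab0 in addchi'.
  by move=> v vM; rewrite -chi'E // (add_on_H_trivial addchi').
case/forall_inPn=> v0 v0M /forallPn[w /forallPn[w' nE]].
have ww' : w != w' by apply: contraNneq nE => ->.
have Rv v : v \in M -> realised phi (phi v) by exists v.
have Rd := realised_delta cphi (Rv _ v0M) ww' nE.
have Rdelta a b : realised phi (fun y => (y == a)%:R - (y == b)%:R).
  have [->|ab] := eqVneq a b.
    by apply: realised_ext (realised0 pact_ker cphi) => y; rewrite subrr.
  have [||||s As [sa sb]] := @alt_move T [:: a; b] [:: w; w'] => //.
  - by rewrite /= inE ab.
  - by rewrite /= inE ww'.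
  - exact: leq_card.
  apply: realised_ext (realised_pact cphi As Rd) => y.
  by rewrite -sa -sb !(inj_eq perm_inj).
suffices phi0 : {in M, forall v y, phi v y = 0} by move=> v vM; rewrite -phiM // phi0.
apply: (supplement_cocycle pact_ker cphi) => h hH.
suffices [v vM vE] : realised phi (phi h) by exists v.
(* Since the values of [phi h] sum to zero, the coefficients at the base point [x] cancel and the
   combination is [phi h]. *)
have Rs := realised_sum pact_ker cphi (index_enum T) (P := predT)
  (fun a _ => realisedZ pact_ker cphi (phi h a) (Rdelta a x)).
apply: realised_ext Rs => y /=.
under eq_bigr do rewrite mulrBr.
rewrite sumrB -mulr_suml sum0 // mul0r subr0 (bigD1 y) //= eqxx mulr1 big1 ?addr0 // => a ay.
by rewrite eq_sym (negPf ay) mulr0.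
Qed.

(** * Functions on pairs of points and their generators *)

Definition pact2 g (q : T * T) := (pi g q.1, pi g q.2).

Lemma pact2_ker : {in M, forall v q, pact2 v q = q}.
Proof. by move=> v vM [x y]; rewrite /pact2 !pi_kerx. Qed.

Lemma realised_pact2 (phi : gT -> T * T -> F) (f : T * T -> F) s : cocycle H pact2 phi ->
  s \in ('Alt_T)%g -> realised phi f -> realised phi (fun q => f (s q.1, s q.2)).
Proof. by move=> cphi /pi_lift[h hH <-] Rf; apply: (realised_act pact2_ker cphi hH Rf). Qed.

(** Only [e = 1] (symmetric) and [e = -1] (antisymmetric) matter. *)
Definition eps_sym (e : F) (f : T * T -> F) := forall x y, f (y, x) = e * f (x, y).

(* Every pair of points is fixed by one of three disjoint transpositions A, B, C,
   so the sum of f over the even products of A, B, C is invariant under A; on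
   such a sum an odd permutation s acts as the even permutation s A. *)
Lemma realised_double_tperm (phi : gT -> T * T -> F) (f : T * T -> F) e (r : seq T) :
  cocycle H pact2 phi -> realised phi f -> eps_sym e f -> uniq r -> (size r <= 4)%N ->
  exists (fN : T * T -> F) a b, [/\ realised phi fN, eps_sym e fN, uniq (r ++ [:: a; b]),
    {in r &, forall x y, fN (x, y) = 4%:R * f (x, y)} &
    forall x y, fN (tperm a b x, tperm a b y) = fN (x, y)].
Proof.
move=> cphi Rf sf Ur r4.
have [|t szt U] := @fresh_seq r 6 Ur.
  by rewrite (leq_trans _ T23) // (leq_trans (leq_add r4 (leqnn 6))).
case: t szt U => [|a [|b [|c [|d [|k [|l [|]]]]]]] //= _ U.
have Uab : uniq (r ++ [:: a; b]).
  by move: U; rewrite -[_ :: _]/([:: a; b] ++ [:: c; d; k; l]) catA cat_uniq => /and3P[].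
move: U; rewrite cat_uniq => /and3P[_ /hasPn tr U].
split_uniq U.
pose A := tperm a b; pose B := tperm c d; pose C := tperm k l.
have AB x : A (B x) = B (A x).
  rewrite /A /B !permE /=.
  have [E|xa] := eqVneq x a; first by subst x; decide_eqs; rewrite /= ?permE /=; decide_eqs.
  have [E|xb] := eqVneq x b; first by subst x; decide_eqs; rewrite /= ?permE /=; decide_eqs.
  have [E|xc] := eqVneq x c; first by subst x; decide_eqs; rewrite /= ?permE /=; decide_eqs.
  have [E|xd] := eqVneq x d; first by subst x; decide_eqs; rewrite /= ?permE /=; decide_eqs.
  by decide_eqs; rewrite /= ?permE /=; decide_eqs.
have AC x : A (C x) = C (A x).
  rewrite /A /C !permE /=.
  have [E|xa] := eqVneq x a; first by subst x; decide_eqs; rewrite /= ?permE /=; decide_eqs.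
  have [E|xb] := eqVneq x b; first by subst x; decide_eqs; rewrite /= ?permE /=; decide_eqs.
  have [E|xk] := eqVneq x k; first by subst x; decide_eqs; rewrite /= ?permE /=; decide_eqs.
  have [E|xl] := eqVneq x l; first by subst x; decide_eqs; rewrite /= ?permE /=; decide_eqs.
  by decide_eqs; rewrite /= ?permE /=; decide_eqs.
have BC x : B (C x) = C (B x).
  rewrite /B /C !permE /=.
  have [E|xa] := eqVneq x c; first by subst x; decide_eqs; rewrite /= ?permE /=; decide_eqs.
  have [E|xb] := eqVneq x d; first by subst x; decide_eqs; rewrite /= ?permE /=; decide_eqs.
  have [E|xk] := eqVneq x k; first by subst x; decide_eqs; rewrite /= ?permE /=; decide_eqs.
  have [E|xl] := eqVneq x l; first by subst x; decide_eqs; rewrite /= ?permE /=; decide_eqs.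
  by decide_eqs; rewrite /= ?permE /=; decide_eqs.
have AA x : A (A x) = x by apply: tpermK.
have moved x : [\/ A x = x /\ B x = x, A x = x /\ C x = x | B x = x /\ C x = x].
  rewrite /A /B /C !permE /=.
  have [E|xa] := eqVneq x a; first by subst x; decide_eqs; apply: Or33.
  have [E|xb] := eqVneq x b; first by subst x; decide_eqs; apply: Or33.
  have [E|xc] := eqVneq x c; first by subst x; decide_eqs; apply: Or32.
  have [E|xd] := eqVneq x d; first by subst x; decide_eqs; apply: Or32.
  by apply: Or31.
pose fN (q : T * T) := f q + f ((A * B)%g q.1, (A * B)%g q.2) +
  f ((A * C)%g q.1, (A * C)%g q.2) + f ((B * C)%g q.1, (B * C)%g q.2).
exists fN, a, b; split=> //.
- have R s : s \in ('Alt_T)%g -> realised phi (fun q => f (s q.1, s q.2)).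
    by move=> As; apply: realised_pact2.
  apply: (realisedD pact2_ker cphi); last by apply/R/tperm2_alt.
  apply: (realisedD pact2_ker cphi); last by apply/R/tperm2_alt.
  by apply: (realisedD pact2_ker cphi) => //; apply/R/tperm2_alt.
- by move=> x y; rewrite /fN /= (sf x) (sf ((A * B)%g x)) (sf ((A * C)%g x)) (sf ((B * C)%g x)); ring.
- have fix_r x : x \in r -> [/\ A x = x, B x = x & C x = x].
    move=> xr; have ne u : u \in [:: a; b; c; d; k; l] -> u != x.
      by move=> /tr; apply: contraNneq => ->.
    by rewrite /A /B /C !tpermD ?ne // !inE eqxx ?orbT.
  move=> x y /fix_r[Ax Bx Cx] /fix_r[Ay By Cy].
  by rewrite /fN /= !permM Ax Bx Cx Ay By Cy; ring.
move=> x y; rewrite -/A /fN /= !permM !AA.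
have [[Ax Ay]|[Bx By]|[Cx Cy]] : [\/ A x = x /\ A y = y, B x = x /\ B y = y | C x = x /\ C y = y].
  by case: (moved x) => -[? ?]; case: (moved y) => -[? ?];
     (by apply: Or31) || (by apply: Or32) || (by apply: Or33).
- by rewrite Ax Ay; ring.
- by rewrite -!AB Bx By; ring.
rewrite -!BC -!AC Cx Cy -!AB; ring.
Qed.

Let ind (u x : T) : F := (x == u)%:R.

(* The flows along a triangle (antisymmetric) and around a square with
   alternating signs (symmetric) span the functions with zero row sums. *)
Definition cyc3 x y z (q : T * T) : F :=
  ind x q.1 * ind y q.2 - ind y q.1 * ind x q.2 + ind y q.1 * ind z q.2
  - ind z q.1 * ind y q.2 + ind z q.1 * ind x q.2 - ind x q.1 * ind z q.2.

Definition sq4 x z y w (q : T * T) : F :=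
  (ind x q.1 - ind z q.1) * (ind y q.2 - ind w q.2)
  + (ind x q.2 - ind z q.2) * (ind y q.1 - ind w q.1).

Let four_neq0 : 4%:R != 0 :> F.
Proof. by rewrite -[4%N]/(2 * 2)%N natrM mulf_neq0. Qed.

Lemma eps_sym_m1_diag (f : T * T -> F) x : eps_sym (-1) f -> f (x, x) = 0.
Proof.
move=> sf; have := sf x x; move/eqP; rewrite mulN1r -subr_eq0 opprK -mulr2n -mulr_natl.
by rewrite mulf_eq0 (negPf two_neq0) => /eqP.
Qed.

(** Take the signed sum of [fN] over the six permutations of [x], [y], [z], the odd ones made even
    by [tperm a b]. It is a multiple of [cyc3 x y z] by 8 times the triangle sum: 4 from [fN] and 2
    from antisymmetry. *)
Lemma realised_cyc3 (phi : gT -> T * T -> F) (f : T * T -> F) x y z :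
  cocycle H pact2 phi -> realised phi f -> eps_sym (-1) f -> uniq [:: x; y; z] ->
  f (x, y) + f (y, z) + f (z, x) != 0 -> realised phi (cyc3 x y z).
Proof.
move=> cphi Rf sf U r0.
have [fN [a [b [RN sN UN fNE fNab]]]] := realised_double_tperm cphi Rf sf U isT.
pose t u w := (tperm u w * tperm a b)%g.
split_uniq UN.
have R s : s \in ('Alt_T)%g -> realised phi (fun q => fN (s q.1, s q.2)).
  by move=> As; apply: realised_pact2.
pose h (q : T * T) := fN q + fN (tc x y z q.1, tc x y z q.2) + fN (tc x z y q.1, tc x z y q.2)
  - fN (t x y q.1, t x y q.2) - fN (t x z q.1, t x z q.2) - fN (t y z q.1, t y z q.2).
have Rh : realised phi h.
  apply: (realisedB pact2_ker cphi); last by apply/R/tperm2_alt.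
  apply: (realisedB pact2_ker cphi); last by apply/R/tperm2_alt.
  apply: (realisedB pact2_ker cphi); last by apply/R/tperm2_alt.
  apply: (realisedD pact2_ker cphi); last by apply/R/tc_even/uniq3_swap.
  by apply: (realisedD pact2_ker cphi) => //; apply/R/tc_even.
have c0 : 8%:R * (f (x, y) + f (y, z) + f (z, x)) != 0.
  by rewrite -[8%N]/(2 * 4)%N natrM !mulf_neq0.
apply: realised_ext (realisedZ pact2_ker cphi (8%:R * (f (x, y) + f (y, z) + f (z, x)))^-1 Rh).
move=> [u w]; apply: (canLR (mulKf c0)); rewrite /h /t /= !permM !fNab.
have xI : x \in [:: x; y; z] by rewrite !inE eqxx.
have yI : y \in [:: x; y; z] by rewrite !inE eqxx orbT.
have zI : z \in [:: x; y; z] by rewrite !inE eqxx !orbT.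
have dN d : fN (d, d) = 0 by apply: eps_sym_m1_diag.
have Exy := fNE x y xI yI; have Eyz := fNE y z yI zI; have Ezx := fNE z x zI xI.
have Eyx : fN (y, x) = - (4%:R * f (x, y)) by rewrite (sN x y) Exy mulN1r.
have Ezy : fN (z, y) = - (4%:R * f (y, z)) by rewrite (sN y z) Eyz mulN1r.
have Exz : fN (x, z) = - (4%:R * f (z, x)) by rewrite (sN z x) Ezx mulN1r.
have [t1 t2 t3] := tc_val U; have [t1' t2' t3'] := tc_val (uniq3_swap U).
have tf d := @tc_fix T x y z d; have tf' d := @tc_fix T x z y d.
rewrite /cyc3 /ind /=.
have [E|ux] := eqVneq u x; [subst u | have [E|uy] := eqVneq u y; [subst u |
  have [E|uz] := eqVneq u z; [subst u|]]];
(have [E|wx] := eqVneq w x; [subst w | have [E|wy] := eqVneq w y; [subst w |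
  have [E|wz] := eqVneq w z; [subst w|]]]);
rewrite ?t1 ?t2 ?t3 ?t1' ?t2' ?t3' ?tf ?tf' ?permE //=; decide_eqs; rewrite ?dN ?Exy ?Eyz ?Ezx ?Eyx ?Ezy ?Exz /=; try ring.
Qed.

(** Apply the product of [1 - (x z)] and [1 - (y w)] to [fN], each single transposition being made
    even by [tperm a b]. *)
Lemma realised_sq4 (phi : gT -> T * T -> F) (f : T * T -> F) x z y w :
  cocycle H pact2 phi -> realised phi f -> eps_sym 1 f -> uniq [:: x; z; y; w] ->
  f (x, y) - f (z, y) - f (x, w) + f (z, w) != 0 -> realised phi (sq4 x z y w).
Proof.
move=> cphi Rf sf U r0.
have [fN [a [b [RN sN UN fNE fNab]]]] := realised_double_tperm cphi Rf sf U isT.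
pose t (u v : T) := (tperm u v * tperm a b)%g.
split_uniq UN.
have R s : s \in ('Alt_T)%g -> realised phi (fun q => fN (s q.1, s q.2)).
  by move=> As; apply: realised_pact2.
pose h (q : T * T) := fN q - fN (t x z q.1, t x z q.2) - fN (t y w q.1, t y w q.2)
  + fN ((tperm x z * tperm y w)%g q.1, (tperm x z * tperm y w)%g q.2).
have Rh : realised phi h.
  apply: (realisedD pact2_ker cphi); last by apply/R/tperm2_alt.
  apply: (realisedB pact2_ker cphi); last by apply/R/tperm2_alt.
  by apply: (realisedB pact2_ker cphi) => //; apply/R/tperm2_alt.
set k := f (x, y) - f (z, y) - f (x, w) + f (z, w) in r0.
have c0 : 4%:R * k != 0 by rewrite mulf_neq0.
apply: realised_ext (realisedZ pact2_ker cphi (4%:R * k)^-1 Rh).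
move=> [u v]; apply: (canLR (mulKf c0)); rewrite /h /t /= !permM !fNab.
have xI : x \in [:: x; z; y; w] by rewrite !inE eqxx.
have zI : z \in [:: x; z; y; w] by rewrite !inE eqxx orbT.
have yI : y \in [:: x; z; y; w] by rewrite !inE eqxx !orbT.
have wI : w \in [:: x; z; y; w] by rewrite !inE eqxx !orbT.
have sym c d : fN (d, c) = fN (c, d) by rewrite sN mul1r.
have Exy := fNE x y xI yI; have Ezy := fNE z y zI yI.
have Exw := fNE x w xI wI; have Ezw := fNE z w zI wI.
have Eyx := sym x y; have Eyz := sym z y; have Ewx := sym x w; have Ewz := sym z w.
have Exz := sym x z; have Eyw := sym y w.
rewrite Exy in Eyx; rewrite Ezy in Eyz; rewrite Exw in Ewx; rewrite Ezw in Ewz.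
rewrite /sq4 /ind /= /k.
have [E|ux] := eqVneq u x; [subst u | have [E|uz] := eqVneq u z; [subst u |
  have [E|uy] := eqVneq u y; [subst u|have [E|uw] := eqVneq u w; [subst u|]]]];
(have [E|vx] := eqVneq v x; [subst v | have [E|vz] := eqVneq v z; [subst v |
  have [E|vy] := eqVneq v y; [subst v|have [E|vw] := eqVneq v w; [subst v|]]]]);
rewrite ?permE /=; decide_eqs; rewrite /= ?permE /=; decide_eqs;
rewrite ?Exy ?Ezy ?Exw ?Ezw ?Eyx ?Eyz ?Ewx ?Ewz ?Exz ?Eyw /=; try ring.
Qed.

Lemma sum_ind (f : T -> F) w : \sum_y f y * ind y w = f w.
Proof.
rewrite (bigD1 w) //= /ind eqxx mulr1 big1 ?addr0 // => y yw.
by rewrite eq_sym (negPf yw) mulr0.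
Qed.

Definition div0 (f : T * T -> F) := forall x, \sum_y f (x, y) = 0.

(** Such an [f] is the sum of [f (x, y) / 2] times [cyc3 x y o] over ordered pairs: zero row sums
    cancel the edges through [o], and each other edge occurs in both orientations. *)
Lemma realised_div0_minus (phi : gT -> T * T -> F) (f : T * T -> F) (o : T) :
  cocycle H pact2 phi -> (forall x y z, uniq [:: x; y; z] -> realised phi (cyc3 x y z)) ->
  eps_sym (-1) f -> div0 f -> realised phi f.
Proof.
move=> cphi Rc sf df.
have Rc' x y : realised phi (cyc3 x y o).
  have R0 (f' : T * T -> F) : (forall q, f' q = 0) -> realised phi f'.
    by move=> E; apply: realised_ext (realised0 pact2_ker cphi) => q; rewrite E.
  have [->|xy] := eqVneq x y; first by apply: R0 => q; rewrite /cyc3; ring.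
  have [->|xo] := eqVneq x o; first by apply: R0 => q; rewrite /cyc3; ring.
  have [->|yo] := eqVneq y o; first by apply: R0 => q; rewrite /cyc3; ring.
  by apply: Rc; rewrite /= !inE negb_or xy xo yo.
have R := realised_sum pact2_ker cphi (index_enum T) (P := predT) (fun x _ =>
  realised_sum pact2_ker cphi (index_enum T) (P := predT) (fun y _ =>
  realisedZ pact2_ker cphi (f (x, y) / 2%:R) (Rc' x y))).
apply: realised_ext R => -[u w] /=.
have row x : \sum_y f (x, y) / 2%:R * cyc3 x y o (u, w) =
    2%:R^-1 * (f (x, w) * ind x u - f (x, u) * ind x w + f (x, u) * ind o w - f (x, w) * ind o u).
  pose k := 2%:R^-1 * (ind o u * ind x w - ind x u * ind o w).
  transitivity (2%:R^-1 * (ind x u - ind o u) * (\sum_y f (x, y) * ind y w)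
     + 2%:R^-1 * (ind o w - ind x w) * (\sum_y f (x, y) * ind y u)
     + k * (\sum_y f (x, y))); last first.
    by rewrite df !(sum_ind (fun y => f (x, y))); ring.
  rewrite !mulr_sumr -!big_split /=; apply: eq_bigr => y _.
  by rewrite /cyc3 /k /=; ring.
have s1 := sum_ind (fun x => f (x, w)) u; have s2 := sum_ind (fun x => f (x, u)) w.
rewrite (eq_bigr _ (fun x _ => row x)) -mulr_sumr !(big_split, sumrN) /= -!mulr_suml.
rewrite s1 s2.
have col y : \sum_x f (x, y) = 0.
  by under eq_bigr do rewrite (sf y); rewrite -mulr_sumr df mulr0.
rewrite !col (sf u w); apply: (mulfI two_neq0); rewrite mulVKf //; ring.
Qed.

Lemma sum_ind1 u : \sum_w ind u w = 1.
Proof.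
rewrite (bigD1 u) //= /ind eqxx big1 ?addr0 // => w wu.
by rewrite (negPf wu).
Qed.

(** Zero row sums force [f (i, x) = - f (o, x)] off [o] and [i], and then [f (o, i) = 0]. So [f] is
    the sum of [f (o, x)] times [sq4 o i x z]; the terms in [z] cancel because row [o] sums to
    zero. *)
Lemma realised_two_stars (phi : gT -> T * T -> F) (f : T * T -> F) o i z :
  cocycle H pact2 phi ->
  (forall x z y w, uniq [:: x; z; y; w] -> realised phi (sq4 x z y w)) ->
  uniq [:: o; i; z] -> eps_sym 1 f -> (forall x, f (x, x) = 0) -> div0 f ->
  (forall u w, u \notin [:: o; i] -> w \notin [:: o; i] -> f (u, w) = 0) -> realised phi f.
Proof.
move=> cphi Rs U sf diag df f0; split_uniq U.
have sym u w : f (w, u) = f (u, w) by rewrite sf mul1r.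
have star x : x \notin [:: o; i] -> f (o, x) + f (i, x) = 0.
  move=> xR; have := df x; rewrite (bigD1 o) //= (bigD1 i) /=; last by rewrite eq_sym.
  rewrite big1 ?addr0 => [|y /andP[yo yi]]; last by rewrite f0 // !inE negb_or yo.
  by rewrite !(sym _ x).
have foi : f (o, i) = 0.
  have : \sum_y (f (o, y) + f (i, y)) = 0 by rewrite big_split /= !df addr0.
  rewrite (bigD1 o) //= (bigD1 i) /=; last by rewrite eq_sym.
  rewrite big1 ?addr0 => [|y /andP[yo yi]]; last by rewrite star // !inE negb_or yo.
  rewrite !diag (sym o i) add0r addr0 => /eqP.
  by rewrite -mulr2n -mulr_natl mulf_eq0 (negPf two_neq0) => /eqP.
have R0 (f' : T * T -> F) : (forall q, f' q = 0) -> realised phi f'.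
  by move=> E; apply: realised_ext (realised0 pact2_ker cphi) => q; rewrite E.
have Rx x : realised phi (fun q => f (o, x) * sq4 o i x z q).
  have [->|xz] := eqVneq x z; first by apply: R0 => q; rewrite /sq4; ring.
  have [->|xo] := eqVneq x o; first by apply: R0 => q; rewrite diag; ring.
  have [->|xi] := eqVneq x i; first by apply: R0 => q; rewrite foi; ring.
  apply: (realisedZ pact2_ker cphi); apply: Rs.
  by rewrite /= !inE !negb_or !(eq_sym _ x) xo xi xz; decide_eqs.
have R := realised_sum pact2_ker cphi (index_enum T) (P := predT) (fun x _ => Rx x).
apply: realised_ext R => -[u w] /=.
transitivity ((ind o u - ind i u) * (\sum_x f (o, x) * ind x w)
  + (ind o w - ind i w) * (\sum_x f (o, x) * ind x u)
  + (- (ind o u - ind i u) * ind z w - (ind o w - ind i w) * ind z u) * (\sum_x f (o, x))).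
  rewrite !mulr_sumr -!big_split /=; apply: eq_bigr => x _; rewrite /sq4 /=; ring.
rewrite df (sum_ind (fun y => f (o, y)) w) (sum_ind (fun y => f (o, y)) u) /ind.
have fio : f (i, o) = 0 by rewrite sym.
have fi y : y != o -> y != i -> f (i, y) = - f (o, y).
  by move=> yo yi; apply/eqP; rewrite -addr_eq0 addrC star // !inE negb_or yo.
have [E|uo] := eqVneq u o; [subst u | have [E|ui] := eqVneq u i; [subst u|]];
  (have [E|wo] := eqVneq w o; [subst w | have [E|wi] := eqVneq w i; [subst w|]]);
  decide_eqs; rewrite ?diag ?foi ?fio /=.
- ring.
- ring.
- ring.
- ring.
- ring.
- by rewrite fi //; ring.
- by rewrite (sym o u) //; ring.
- by rewrite (sym i u) fi //; ring.
by rewrite (f0 u w) ?inE ?negb_or ?uo ?wo //; ring.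
Qed.

(** Squares [sq4 x o y i] reproduce [f] on pairs avoiding [o] and [i]; the remainder is covered by
    [realised_two_stars]. *)
Lemma realised_div0_plus (phi : gT -> T * T -> F) (f : T * T -> F) :
  cocycle H pact2 phi ->
  (forall x z y w, uniq [:: x; z; y; w] -> realised phi (sq4 x z y w)) ->
  eps_sym 1 f -> (forall x, f (x, x) = 0) -> div0 f -> realised phi f.
Proof.
move=> cphi Rs sf diag df.
have [||t szt U] := @fresh_seq [::] 3 => //; first exact: leq_card.
case: t szt U => [|o [|i [|z [|]]]] //= _ U0.
have U : uniq [:: o; i; z] by []; have U' := U; split_uniq U'.
have sym u w : f (w, u) = f (u, w) by rewrite sf mul1r.
pose fR x y := if (x \notin [:: o; i]) && (y \notin [:: o; i]) then f (x, y) else 0.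
have R0 (f' : T * T -> F) : (forall q, f' q = 0) -> realised phi f'.
  by move=> E; apply: realised_ext (realised0 pact2_ker cphi) => q; rewrite E.
pose S (q : T * T) := \sum_x \sum_y fR x y / 2%:R * sq4 x o y i q.
have RS : realised phi S.
  apply: (realised_sum pact2_ker cphi) => x _; apply: (realised_sum pact2_ker cphi) => y _.
  rewrite /fR; case: ifP => [/andP[xR yR]|_]; last by apply: R0 => q; rewrite !mul0r.
  have [->|xy] := eqVneq x y; first by apply: R0 => q; rewrite diag !mul0r.
  apply: (realisedZ pact2_ker cphi); apply: Rs.
  move: xR yR; rewrite /= !inE !negb_or => /andP[xo xi] /andP[yo yi].
  by decide_eqs.
suffices RG : realised phi (fun q => f q - S q).
  by apply: realised_ext (realisedD pact2_ker cphi RG RS) => q; rewrite subrK.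
apply: (realised_two_stars cphi Rs U).
- move=> u w; rewrite mul1r sym; congr (_ - _).
  by apply: eq_bigr => x _; apply: eq_bigr => y _; rewrite /sq4 /=; ring.
- move=> u; rewrite diag sub0r; apply/eqP; rewrite oppr_eq0; apply/eqP.
  rewrite /S big1 // => x _; rewrite big1 // => y _.
  rewrite /fR; case: ifP => [/andP[xR yR]|_]; last by rewrite !mul0r.
  have [->|xy] := eqVneq x y; first by rewrite diag !mul0r.
  move: xR yR; rewrite /= !inE !negb_or => /andP[xo xi] /andP[yo yi].
  rewrite /sq4 /ind /=.
  have [E|ux] := eqVneq u x; [subst u; decide_eqs; ring|].
  have [E|uo] := eqVneq u o; [subst u; decide_eqs; ring|].
  by ring.
- move=> u; rewrite sumrB df sub0r; apply/eqP; rewrite oppr_eq0; apply/eqP.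
  rewrite /S exchange_big big1 //= => x _; rewrite exchange_big big1 //= => y _.
  rewrite -mulr_sumr /sq4 /= big_split /= -mulr_sumr -mulr_suml !sumrB !sum_ind1.
  by rewrite !subrr mulr0 mul0r addr0 mulr0.
move=> u w uR wR; apply/eqP; rewrite subr_eq0; apply/eqP.
have fRE x y : x \notin [:: o; i] -> y \notin [:: o; i] -> fR x y = f (x, y).
  by rewrite /fR => -> ->.
have row x : \sum_y fR x y / 2%:R * sq4 x o y i (u, w) =
    2%:R^-1 * (fR x w * ind x u + fR x u * ind x w).
  rewrite -(sum_ind (fR x) w) -(sum_ind (fR x) u) !mulr_suml -big_split mulr_sumr /=.
  apply: eq_bigr => y _; rewrite /sq4 /ind /=.
  move: uR wR; rewrite !inE !negb_or => /andP[uo ui] /andP[wo wi].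
  by decide_eqs; rewrite /=; ring.
rewrite /S (eq_bigr _ (fun x _ => row x)) -mulr_sumr big_split /=.
have s1 := sum_ind (fun x => fR x w) u; have s2 := sum_ind (fun x => fR x u) w.
rewrite s1 s2 !fRE // (sym u w); apply: (mulfI two_neq0); rewrite mulVKf //; ring.
Qed.

(** * Cocycles vanish on M *)

Lemma cocycle_point_trivial (th : gT -> T -> F) : cocycle H pact th ->
  {in M, forall v x, th v x = 0}.
Proof.
move=> cth v vM x; apply: (point_hom_trivial (x := x) (chi := th^~ x)) vM.
by move=> g h /pt_stab1P[gH gx] /pt_stab1P[hH hx]; rewrite cth // /pact gx.
Qed.

(** At [x0] the cocycle is a homomorphism on the stabiliser of [x0], trivial on [M] and hence zero.
    So [th h x0] depends only on the image of [x0] under [h], which defines [b]. *)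
Lemma cocycle_coboundary (th : gT -> T -> F) : cocycle H pact th ->
  exists b : T -> F, \sum_x b x = 0 /\ {in H, forall h x, th h x = b (pi h x) - b x}.
Proof.
move=> cth; have [x0 _] : exists x0 : T, x0 \in T.
  by have := leq_card (isT : 1 <= 23)%N; case/card_gt0P=> x0; exists x0.
pose t w := odflt 1%g [pick h in H | pi h x0 == w].
have tP w : t w \in H /\ pi (t w) x0 = w.
  rewrite /t; case: pickP => [h /andP[hH /eqP]|none] //=.
  by have [h hH hE] := alt_trans1 x0 w; have := none h; rewrite hH hE eqxx.
have add0 : additive_on (pt_stab [set x0]) (th^~ x0).
  by move=> g h /pt_stab1P[gH gx] /pt_stab1P[hH hx]; rewrite cth // /pact gx.
have stab0 h : h \in pt_stab [set x0] -> th h x0 = 0.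
  apply: (add_on_trivial (chi := th^~ x0)) => //; first by rewrite cards1 leq_card.
  by move=> v vM; apply: cocycle_point_trivial.
pose b w := th (t w) x0; have bE : {in H, forall h x, th h x = b (pi h x) - b x}.
  move=> h hH x; have [tH tE] := tP x; have [t'H t'E] := tP (pi h x).
  apply/eqP; rewrite eq_sym subr_eq addrC; apply/eqP; rewrite /b.
  have := cth _ _ tH hH x0; rewrite /pact tE => <-.
  have kS : (t x * h * (t (pi h x))^-1)%g \in pt_stab [set x0].
    apply/pt_stab1P; split; first by rewrite !groupM ?groupV.
    rewrite piM ?groupM ?groupV // piM // tE -{2}t'E -piM ?groupV //.
    by rewrite mulgV pi1.
  have [kH kx] := pt_stab1P _ _ kS.
  rewrite -(mulgKV (t (pi h x)) (t x * h)%g) (cth _ _ kH t'H) (stab0 _ kS) add0r.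
  by rewrite /pact kx.
(* Subtracting the mean needs [#|T|] invertible in [F], and does not change the coboundary. *)
pose m := (\sum_x b x) / #|T|%:R.
exists (fun x => b x - m); split; last by move=> h hH x; rewrite bE //; ring.
rewrite sumrB sumr_const -[#|_|]/#|T| -mulr_natr /m divfK // subrr //.
Qed.

Lemma div_cocycle (phi : gT -> T * T -> F) : cocycle H pact2 phi ->
  cocycle H pact (fun h x => \sum_y phi h (x, y)).
Proof.
move=> cphi g h gH hH x; under eq_bigr do rewrite cphi //.
rewrite big_split /=; congr (_ + _).
by rewrite [RHS](reindex_inj (@perm_inj _ (pi g))).
Qed.

(** Put [b] on the star of pairs through [o]. In the symmetric case this leaves [2 * b o] at
    [(o, o)], which the square [sq4 o i o z] removes: its row sums vanish and its only diagonal
    entry is 2, at [o]. *)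
Lemma div_onto (e : F) (b : T -> F) : e = 1 \/ e = -1 -> \sum_x b x = 0 ->
  exists B : T * T -> F, [/\ eps_sym e B, forall x, B (x, x) = 0 & forall x, \sum_y B (x, y) = b x].
Proof.
move=> e1 b0; have [||t szt U] := @fresh_seq [::] 3 => //; first exact: leq_card.
case: t szt U => [|o [|i [|z [|]]]] //= _ U; split_uniq U.
have div1 (k : F) u : \sum_w (ind o w * b u + k * ind o u * b w) = b u.
  by rewrite big_split /= -mulr_suml -mulr_sumr sum_ind1 b0 mulr0 addr0 mul1r.
case: e1 => ->; last first.
  exists (fun q => ind o q.2 * b q.1 + (-1) * ind o q.1 * b q.2); split=> [u w|u|u] /=.
  - ring.
  - ring.
  exact: div1.
exists (fun q => ind o q.2 * b q.1 + 1 * ind o q.1 * b q.2 - b o * sq4 o i o z q).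
split=> [u w|u|u] /=.
- by rewrite /sq4 /=; ring.
- rewrite /sq4 /ind /=; have [E|uo] := eqVneq u o; first by subst u; decide_eqs; rewrite /=; ring.
  have [E|ui] := eqVneq u i; first by subst u; decide_eqs; rewrite /=; ring.
  by rewrite /=; ring.
rewrite sumrB div1 -mulr_sumr /sq4 /= big_split /= -mulr_sumr -mulr_suml !sumrB !sum_ind1.
by rewrite !subrr mulr0 mul0r addr0 mulr0 subr0.
Qed.

(** The row sums form a cocycle on points, which is the coboundary of some [b]; lift [b] to [B] by
    [div_onto] and subtract its coboundary, which is zero on [M]. *)
Lemma div0_cocycle (phi : gT -> T * T -> F) e : e = 1 \/ e = -1 ->
  cocycle H pact2 phi -> (forall h, eps_sym e (phi h)) -> (forall h x, phi h (x, x) = 0) ->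
  exists psi : gT -> T * T -> F, [/\ cocycle H pact2 psi, {in M, forall v q, psi v q = phi v q} &
    {in H, forall h, [/\ eps_sym e (psi h), forall x, psi h (x, x) = 0 & div0 (psi h)]}].
Proof.
move=> e1 cphi sphi dphi.
have [b [b0 bE]] := cocycle_coboundary (div_cocycle cphi).
have [B [sB dB divB]] := div_onto e1 b0.
exists (fun h q => phi h q - (B (pact2 h q) - B q)); split.
- move=> g h gH hH q; rewrite cphi //.
  have -> : pact2 (g * h)%g q = pact2 h (pact2 g q) by rewrite /pact2 !piM.
  ring.
- by move=> v vM q; rewrite pact2_ker // subrr subr0.
move=> h hH; split=> [x y|x|x].
- by rewrite /pact2 /= sphi !(sB x) !(sB (pi h x)); ring.
- by rewrite /pact2 /= dphi !dB; ring.
rewrite !sumrB bE // divB /pact2 /=.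
have <- : \sum_y B (pi h x, pi h y) = b (pi h x).
  by rewrite -divB [RHS](reindex_inj (@perm_inj _ (pi h))).
by rewrite subrr.
Qed.

(** A nonzero triangle sum on [M] yields every [cyc3] by transitivity. If all vanish, then [psi v
    (x, y) = psi v (x, z) + psi v (z, y)], and summing over [z] gives [#|T|] times [psi v (x, y)]
    equal to zero. *)
Lemma minus_cocycle_trivial (phi : gT -> T * T -> F) : cocycle H pact2 phi ->
  (forall h, eps_sym (-1) (phi h)) -> {in M, forall v q, phi v q = 0}.
Proof.
move=> cphi sphi; have dphi h x := eps_sym_m1_diag x (sphi h).
have [psi [cpsi psiM psiP]] := div0_cocycle (or_intror erefl) cphi sphi dphi.
suffices psi0 : {in M, forall v q, psi v q = 0} by move=> v vM q; rewrite -psiM // psi0.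
have Rv v : v \in M -> realised psi (psi v) by exists v.
case: (pickP [pred q : gT * (T * T * T) | [&& q.1 \in M, uniq [:: q.2.1.1; q.2.1.2; q.2.2] &
    psi q.1 (q.2.1.1, q.2.1.2) + psi q.1 (q.2.1.2, q.2.2) + psi q.1 (q.2.2, q.2.1.1) != 0]]).
  case=> v [[x y] z] /and3P[/= vM U r0].
  have [sv _ _] := psiP v (inH vM).
  have Rc := realised_cyc3 cpsi (Rv _ vM) sv U r0.
  have Rall a b c : uniq [:: a; b; c] -> realised psi (cyc3 a b c).
    move=> U'; have [||||s As [sa sb sc]] := @alt_move T [:: a; b; c] [:: x; y; z] => //.
      exact: leq_card.
    apply: realised_ext (realised_pact2 cpsi As Rc) => q.
    by rewrite /cyc3 /ind /= -sa -sb -sc !(inj_eq perm_inj).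
  apply: (supplement_cocycle pact2_ker cpsi) => h hH.
  have [sh _ dh] := psiP h hH.
  by have [v' v'M v'E] := realised_div0_minus x cpsi Rall sh dh; exists v'.
move=> none v vM [x y]; have [sv dv dvh] := psiP v (inH vM).
have [->|xy] := eqVneq x y; first exact: dv.
have anti c d : psi v (d, c) = - psi v (c, d) by rewrite sv mulN1r.
have r0 z : z != x -> z != y -> psi v (x, y) = psi v (x, z) + psi v (z, y).
  move=> zx zy; have := none (v, (x, y, z)); rewrite /= vM /= !inE !negb_or xy !(eq_sym _ z) zx zy /=.
  move/negbFE/eqP; rewrite (anti z y) (anti x z) => E.
  by apply/eqP; rewrite -subr_eq0 -E; apply/eqP; ring.
have : \sum_(z : T) psi v (x, y) = \sum_z (psi v (x, z) + psi v (z, y)).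
  apply: eq_bigr => z _; have [->|zx] := eqVneq z x; first by rewrite dv add0r.
  by have [->|zy] := eqVneq z y; [rewrite dv addr0 | apply: r0].
rewrite big_split /= dvh add0r sumr_const -[#|_|]/#|T|.
have -> : \sum_z psi v (z, y) = 0.
  by under eq_bigr do rewrite anti; rewrite sumrN dvh oppr0.
by move/eqP; rewrite -mulr_natl mulf_eq0 (negPf card_neq0) => /eqP.
Qed.

Lemma cocycle_conj2 (phi : gT -> T * T -> F) h v q : cocycle H pact2 phi ->
  h \in H -> v \in M -> phi (v ^ h)%g q = phi v (pact2 h^-1%g q).
Proof.
move=> cphi hH vM; rewrite -{1}[h]invgK.
by rewrite (cocycle_conjH pact2_ker cphi) ?groupV.
Qed.

Lemma plus_cocycle_trivial (phi : gT -> T * T -> F) : cocycle H pact2 phi ->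
  (forall h, eps_sym 1 (phi h)) -> (forall h x, phi h (x, x) = 0) ->
  {in M, forall v q, phi v q = 0}.
Proof.
move=> cphi sphi dphi.
have [psi [cpsi psiM psiP]] := div0_cocycle (or_introl erefl) cphi sphi dphi.
suffices psi0 : {in M, forall v q, psi v q = 0} by move=> v vM q; rewrite -psiM // psi0.
have Rv v : v \in M -> realised psi (psi v) by exists v.
case: (pickP [pred q : gT * (T * T * (T * T)) | let: (v, (x, z, (y, w))) := q in
    [&& v \in M, uniq [:: x; z; y; w] &
    psi v (x, y) - psi v (z, y) - psi v (x, w) + psi v (z, w) != 0]]).
  case=> v [[x z] [y w]] /and3P[/= vM U r0].
  have [sv _ _] := psiP v (inH vM).
  have Rs := realised_sq4 cpsi (Rv _ vM) sv U r0.
  have Rall a c b d : uniq [:: a; c; b; d] -> realised psi (sq4 a c b d).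
    move=> U'; have [||||s As [sa sc sb sd]] := @alt_move T [:: a; c; b; d] [:: x; z; y; w] => //.
      exact: leq_card.
    apply: realised_ext (realised_pact2 cpsi As Rs) => q.
    by rewrite /sq4 /ind /= -sa -sb -sc -sd !(inj_eq perm_inj).
  apply: (supplement_cocycle pact2_ker cpsi) => h hH.
  have [sh dh d0h] := psiP h hH.
  by have [v' v'M v'E] := realised_div0_plus cpsi Rall sh dh d0h; exists v'.
move=> none.
have rel v x z y w : v \in M -> uniq [:: x; z; y; w] ->
    psi v (x, y) - psi v (z, y) - psi v (x, w) + psi v (z, w) = 0.
  move=> vM U; apply: contraFeq (none (v, (x, z, (y, w)))) => nz.
  by apply/and3P; split.
pose f3 x y z v := psi v (x, y) + psi v (x, z) - psi v (y, z).
have f3C v x y z : v \in M -> f3 x z y v = f3 x y z v.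
  by move=> vM; have [sv _ _] := psiP v (inH vM); rewrite /f3 (sv y z) mul1r; ring.
have f3w v x y z w : v \in M -> uniq [:: x; y; z; w] -> f3 x y z v = f3 x y w v.
  move=> vM U; apply/eqP; rewrite -subr_eq0; apply/eqP.
  by rewrite -(rel v x y z w vM U) /f3; ring.
(* Both pairs are compared with a pair of fresh points, one exchange at a time. *)
have f3E v x y z y' z' : v \in M -> uniq [:: x; y; z] -> uniq [:: x; y'; z'] ->
    f3 x y z v = f3 x y' z' v.
  move=> vM U U'; pose r := undup [:: x; y; z; y'; z'].
  have [||t szt Ur] := @fresh_seq r 2; first exact: undup_uniq.
    by rewrite (leq_trans (leq_add (size_undup _) (leqnn 2))) // leq_card.
  case: t szt Ur => [|w [|w' [|]]] //= _; rewrite cat_uniq => /and3P[_ /hasPn wr Uw].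
  have nw u : u \in [:: w; w'] -> [/\ x != u, y != u, z != u, y' != u & z' != u].
    move=> /wr; rewrite /= mem_undup !inE !negb_or !(eq_sym u) => /and5P[*]; split=> //.
  have [xw yw zw y'w z'w] := nw w (mem_head _ _).
  have [xw' yw' zw' y'w' z'w'] := nw w' (mem_last w [:: w']).
  have red a b : uniq [:: x; a; b] -> a != w -> b != w -> a != w' -> b != w' ->
      f3 x a b v = f3 x w w' v.
    move=> Uab aw bw aw' bw'; split_uniq Uab; split_uniq Uw.
    rewrite (f3w v x a b w) //; last by rewrite /= !inE !negb_or; decide_eqs.
    rewrite f3C // (f3w v x w a w') // /= !inE !negb_or; decide_eqs => //.
  by rewrite (red y z) ?(red y' z').
have f3_inv x y z h v : uniq [:: x; y; z] -> h \in pt_stab [set x] -> v \in M ->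
    f3 x y z (v ^ h)%g = f3 x y z v.
  move=> U /pt_stab1P[hH hx] vM; rewrite /f3 !cocycle_conj2 // /pact2 /=.
  have hVx : pi h^-1%g x = x by rewrite -{1}hx -piM ?groupV // mulgV pi1.
  rewrite hVx -/(f3 x (pi h^-1%g y) (pi h^-1%g z) v); apply: f3E => //.
  by rewrite -{1}hVx -[[:: _; _; _]]/(map (pi h^-1%g) [:: x; y; z]) map_inj_uniq //; apply: perm_inj.
have f3_0 v x y z : v \in M -> uniq [:: x; y; z] -> f3 x y z v = 0.
  move=> vM U; have U' := U; split_uniq U'.
  have memS (D : {set T}) a h : h \in pt_stab (a |: D) -> pi h a = a.
    by case/pt_stabP=> _; apply; rewrite setU11.
  (* [f3 x y z] is a homomorphism on the stabiliser of three points, invariant under that of [x]; it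
     is extended by freeing first [z], then [y]. *)
  have [||||chi [addchi chiE]] := @extend_invariant (y |: [set x]) z (f3 x y z).
  - by rewrite !inE negb_or; decide_eqs.
  - by apply: leq_trans (leq_card (isT : 11 <= 23)%N); rewrite cardsU1 cards1; case: (_ \notin _).
  - move=> g h gS hS; have [gS' gz] := pt_stabU1 _ _ _ gS; have [hS' hz] := pt_stabU1 _ _ _ hS.
    have [/pt_stab1P[gH gx] gy] := pt_stabU1 _ _ _ gS'; have [/pt_stab1P[hH hx] hy] := pt_stabU1 _ _ _ hS'.
    by rewrite /f3 !cpsi // /pact2 /= gx gy gz; ring.
  - move=> h u hS uM; apply: f3_inv => //.
    by apply: (subsetP (pt_stabS (subsetUr _ _))) hS.
  have [||||chi' [addchi' chi'E]] := @extend_invariant [set x] y chi.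
  - by rewrite !inE; decide_eqs.
  - by rewrite cards1 leq_card.
  - exact: addchi.
  - move=> h u hS uM; have hH : h \in H by case/pt_stab1P: hS.
    have uhM : (u ^ h)%g \in M by rewrite memJ_norm // -kerE (subsetP (ker_norm pi)).
    by rewrite !chiE // f3_inv.
  by rewrite -chiE // -chi'E // (point_hom_trivial addchi').
move=> v vM [x y]; have [sv dv _] := psiP v (inH vM).
have [->|xy] := eqVneq x y; first exact: dv.
have [||t szt U] := @fresh_seq [:: x; y] 1; first by rewrite /= inE xy.
  exact: leq_card.
case: t szt U => [|z [|]] //= _ U.
have U' : uniq [:: y; x; z] by apply/uniq3_rot/uniq3_rot/uniq3_swap.
(* Adding the relations based at [x] and at [y] leaves [2 * psi v (x, y)]. *)
have := f3_0 v x y z vM U; have := f3_0 v y x z vM U'; rewrite /f3 (sv x y) mul1r => E1 E2.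
apply: (mulfI two_neq0); rewrite mulr0 -[RHS](addr0 0) -{1}E1 -E2; ring.
Qed.

Lemma pair_hom_trivial x0 y0 (chi : gT -> F) : x0 != y0 ->
  additive_on (pt_stab [set x0; y0]) chi -> {in M, forall v, chi v = 0}.
Proof.
move=> xy0 addchi.
have stE h : (h \in pt_stab [set x0; y0]) = (h \in H) && (pact2 h (x0, y0) == (x0, y0)).
  apply/pt_stabP/andP=> -[hH]; first by move=> hD; rewrite /pact2 /= !hD ?set21 ?set22.
  by move=> /eqP[hx hy]; split=> // z /set2P[]->.
have [phi [cphi phix phi0]] : exists phi : gT -> T * T -> F, [/\ cocycle H pact2 phi,
    forall g, g \in H -> pact2 g (x0, y0) = (x0, y0) -> phi g (x0, y0) = chi g &
    forall g q, q \notin [pred q : T * T | q.1 != q.2] -> phi g q = 0].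
  apply: cocycle_of_stab => //.
  - by case=> x y; rewrite /pact2 !pi1.
  - by move=> g h gH hH [x y]; rewrite /pact2 !piM.
  - by move=> g q gH; rewrite !inE /= (inj_eq perm_inj).
  - case=> x y; rewrite inE /= => xy.
    have [||||s As [sx sy]] := @alt_move T [:: x0; y0] [:: x; y].
    - by rewrite /= inE xy0.
    - by rewrite /= inE xy.
    - by [].
    - exact: leq_card.
    by have [h hH hE] := pi_lift As; exists h; rewrite // /pact2 /= hE sx sy.
  by move=> g h gS hS; apply: addchi; rewrite stE; [move: gS | move: hS]; rewrite inE.
(* Twice [phi] is the sum of its symmetric and antisymmetric parts, each again a cocycle. *)
pose swap (q : T * T) := (q.2, q.1).
have cs e : cocycle H pact2 (fun h q => phi h q + e * phi h (swap q)).
  by move=> g h gH hH [x y]; rewrite !cphi //; ring.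
have diag h x : phi h (x, x) = 0 by rewrite phi0 // inE /= eqxx.
have plus0 : {in M, forall v q, phi v q + 1 * phi v (swap q) = 0}.
  apply: plus_cocycle_trivial (cs 1) _ _ => [h x y|h x]; rewrite /swap /=; first by ring.
  by rewrite diag; ring.
have minus0 : {in M, forall v q, phi v q + (-1) * phi v (swap q) = 0}.
  by apply: minus_cocycle_trivial (cs (-1)) _ => h x y; rewrite /swap /=; ring.
move=> v vM; rewrite -phix ?inH //; last by rewrite pact2_ker.
apply: (mulfI two_neq0); rewrite mulr0 -[RHS](addr0 0).
by rewrite -{1}(plus0 v vM (x0, y0)) -(minus0 v vM (x0, y0)); ring.
Qed.

End Extension.

(** * Reduction to a two-point stabiliser *)

(** Pair the factors [i.+1] and [n - i]; each product is at least [n]. *)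
Lemma expn_self_leq_fact2 n : (n ^ n <= n`! * n`!)%N.
Proof.
have -> : (n`! * n`! = \prod_(i < n) (i.+1 * (n - i)))%N.
  rewrite big_split /= fact_prod big_add1 /= big_mkord; congr (_ * _)%N.
  by rewrite (reindex_inj rev_ord_inj) /=; apply: eq_bigr => i _; rewrite /= subnSK.
rewrite -{2}[n]card_ord -prod_nat_const; apply: leq_prod => i _.
by have := ltn_ord i; nia.
Qed.

Lemma quadratic_leq_exp3 d : 5 <= d -> (4 * d + 1) * (2 * d + 1) <= 3 ^ d.
Proof.
elim: d => // d IHd; rewrite leq_eqVlt => /predU1P[<- //|].
rewrite ltnS expnS => d5; have := IHd d5; move: (3 ^ d)%N => e; nia.
Qed.

(** The bounds on [m] force [4 * d + 2 <= n]. If the claim failed, squaring and [m <= n ^ 2] would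
    give [n ^ n <= 4 * n ^ (4 * d)]. *)
Lemma expn_lt_fact n m d : 21 <= n -> 3 ^ d <= m -> 2 * m < n * n.+1 -> 2 * m ^ d < n`!.
Proof.
move=> n21 le3 lt2.
have d4 : 4 * d + 2 <= n.
  have [d5|] := leqP 5 d; last by lia.
  rewrite leqNgt; apply/negP=> ltn; have := leq_trans (quadratic_leq_exp3 d5) le3.
  move=> {le3} le3; have : n * n.+1 <= (4 * d + 1) * (4 * d + 2) by apply: leq_mul; lia.
  by nia.
have mn : m <= n ^ 2 by rewrite -mulnn; nia.
have le_md : m ^ d <= n ^ (2 * d) by rewrite expnM; case: (d) => [|e] //; rewrite leq_exp2r.
rewrite ltnNge; apply/negP=> le_fact.
have : n ^ n <= 4 * n ^ (4 * d).
  apply: leq_trans (expn_self_leq_fact2 n) _.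
  apply: leq_trans (leq_mul le_fact le_fact) _.
  have -> : (4 * d = 2 * d + 2 * d)%N by lia.
  by rewrite expnD mulnACA leq_mul // leq_mul.
apply/negP; rewrite -ltnNge; apply: leq_trans (leq_pexp2l _ d4); last by lia.
by rewrite addn2 !expnS mulnA ltn_mul2r expn_gt0; nia.
Qed.

(** Adjoin generators of [U] one by one. Each multiplies the order of the subgroup [B] generated so
    far by at least 3, since [#|U|] is odd, and the index of its centraliser by at most [#|U|], as
    conjugates stay in [U]. *)
Lemma cent_index_bound (gT : finGroupType) (G U : {group gT}) :
  odd #|U| -> G \subset 'N(U) -> exists d, 3 ^ d <= #|U| /\ #|G : 'C_G(U)| <= #|U| ^ d.
Proof.
move=> oddU nUG.
suffices H (B : {group gT}) d : B \subset U -> 3 ^ d <= #|B| -> #|G : 'C_G(B)| <= #|U| ^ d ->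
    exists e, 3 ^ e <= #|U| /\ #|G : 'C_G(U)| <= #|U| ^ e.
  apply: (H 1%G 0); rewrite ?sub1G ?cards1 // (setIidPl _) ?indexgg //.
  by rewrite cents1.
have [n] := ubnP #|U : B|; elim: n B d => // n IHn B d; rewrite ltnS => le_n sBU le3 leC.
have [sUB|/subsetPn[a Ua nBa]] := boolP (U \subset B).
  have E : U :=: B by apply/eqP; rewrite eqEsubset sUB.
  by exists d; rewrite E -{3}E.
pose B' := (B <*> <[a]>)%G.
have sB'U : B' \subset U by rewrite join_subG sBU cycle_subG.
have sBB' : B \subset B' by apply: joing_subl.
have aB' : a \in B' by rewrite -cycle_subG joing_subr.
have ltB : 3 <= #|B' : B|.
  have : odd #|B' : B| by apply: dvdn_odd oddU; apply: dvdn_trans (dvdn_indexg _ _) (cardSg sB'U).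
  have : 1 < #|B' : B| by rewrite indexg_gt1; apply: contra nBa => /subsetP->.
  by case: #|_ : _| => [|[|[|m]]].
apply: (IHn B' d.+1) => //.
- apply: leq_trans le_n; rewrite -(Lagrange_index sB'U sBB') -{1}[#|U : B'|]muln1.
  by rewrite ltn_mul2l indexg_gt0 (leq_trans _ ltB).
- by rewrite expnS -(Lagrange sBB') mulnC leq_mul.
have cB' : 'C_G(B') = 'C_('C_G(B))[a].
  by rewrite /= centY cent_cycle setIA.
have sCC : 'C_G(B') \subset 'C_G(B) by rewrite cB' subsetIl.
have leU : #|'C_G(B) : 'C_G(B')| <= #|U|.
  rewrite cB' index_cent1; apply/subset_leq_card/subsetP=> _ /imsetP[g /setIP[Gg _] ->].
  by rewrite memJ_norm // (subsetP nUG).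
by rewrite -(Lagrange_index (subsetIl G 'C(B)) sCC) expnSr leq_mul.
Qed.

Lemma prime_index_hom (gT : finGroupType) (G R : {group gT}) p : R <| G -> prime p ->
  #|G : R| = p -> exists2 chi : gT -> 'F_p, additive_on G chi &
    {in G, forall g, chi g = 0%R -> g \in R}.
Proof.
move=> nRG p_pr idx; have [sRG nRG'] := andP nRG.
have cQ : #|G / R| = p by rewrite card_quotient.
have cF : #|[set: 'F_p]| = p by rewrite cardsT card_Fp.
have iso : G / R \isog [set: 'F_p].
  by rewrite isog_cyclic_card ?prime_cyclic ?cQ ?cF // eqxx.
have [phi injphi _] := isogP iso.
have memQ g : g \in G -> coset R g \in G / R by move=> gG; rewrite mem_quotient.
exists (fun g => phi (coset R g)) => [g h gG hG | g gG].
  have nR x : x \in G -> x \in 'N(R) by apply: subsetP.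
  by rewrite morphM ?nR // morphM ?memQ.
move=> phi0; apply: coset_idr; first exact: (subsetP nRG').
apply: (injmP injphi); rewrite ?group1 ?memQ // morph1; exact: phi0.
Qed.

(** * The stabiliser of two points in the alternating group *)

Section TwoPoints.
Variables (T : finType) (x y : T).
Hypotheses (xy : x != y) (T8 : 8 <= #|T|).

Definition alt2 := [set s in 'Alt_T | (s x == x) && (s y == y)].

Lemma alt2P s : reflect [/\ s \in 'Alt_T, s x = x & s y = y] (s \in alt2).
Proof.
rewrite [s \in alt2]in_set; apply: (iffP and3P) => -[As sx sy]; split=> //.
- exact/eqP.
- exact/eqP.
- exact/eqP.
exact/eqP.
Qed.

Lemma alt2_group_set : group_set alt2.
Proof.
apply/group_setP; split=> [|s t].
  by apply/alt2P; rewrite group1 !perm1.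
move=> /alt2P[As sx sy] /alt2P[At tx ty]; apply/alt2P.
by rewrite groupM // !permM sx sy tx ty.
Qed.

Canonical alt2_group := Group alt2_group_set.

Let T1 := {z | z != x}.
Let yx : y != x. Proof. by rewrite eq_sym. Qed.
Let y1 : T1 := Sub y yx.

Let card_T1 : #|{: T1}| = #|T|.-1.
Proof. by rewrite card_sig -(cardC1 x); apply: eq_card => z; rewrite !inE. Qed.

(** The points are removed one at a time: restriction to [T1] carries [alt2] onto the stabiliser of
    [y1] in ['Alt_T1], to which [rfd_iso] applies. *)
Lemma alt2_isog : alt2 \isog 'Alt_{z : T1 | z != y1}.
Proof.
have sD : alt2 \subset 'C_('Sym_T)[x | 'P].
  by apply/subsetP=> s /alt2P[_ sx _]; rewrite 2!inE; apply/astab1P.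
apply: (isog_trans _ (rfd_iso y1)).
pose f := restrm sD (rfd_morphism x).
have valf s u : s \in alt2 -> val (f s u) = s (val u).
  by move=> /alt2P[_ sx _]; rewrite /f /= /restrm permE /= sx eqxx.
apply/isogP; exists [morphism of f].
  apply/injmP=> s t As At E; apply/permP=> z; have [->|zx] := eqVneq z x.
    by case/alt2P: As => _ -> _; case/alt2P: At => _ -> _.
  have := congr1 (fun g : {perm T1} => val (g (Sub z zx))) E.
  by rewrite [LHS]valf // [RHS]valf.
apply/setP=> s'; apply/morphimP/setIP=> [[s _ As ->]|[As' /astab1P s'y]].
  have [Es sx sy] := alt2P _ As; split.
    by rewrite Alt_even /f /= /restrm rfd_odd // -Alt_even.
  by apply/astab1P; apply: val_inj; rewrite /= /aperm valf.
have rgdx : rgd s' x = x by rewrite permE /= insubF //= eqxx.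
have rfd_rgd : rfd x (rgd s') = s'.
  apply/permP => u; apply: val_inj; rewrite permE /= rgdx eqxx permE /=.
  by rewrite valK.
have As2 : rgd s' \in alt2.
  apply/alt2P; split=> //; first by rewrite Alt_even -(rfd_odd rgdx) rfd_rgd -Alt_even.
  rewrite permE /=; case: insubP => [u _ uE|]; last by rewrite yx.
  have -> : u = y1 by apply: val_inj.
  by rewrite -[s' y1]/('P%act y1 s') s'y.
by exists (rgd s'); rewrite // /f /= /restrm rfd_rgd.
Qed.

Lemma alt2_simple : simple alt2.
Proof.
rewrite (isog_simple alt2_isog) simple_Alt5 // card_sig.
have -> : #|[pred z : T1 | z != y1]| = #|predC1 y1| by apply: eq_card => z; rewrite !inE.
by rewrite cardC1 card_T1; lia.
Qed.

Lemma card_alt2 : (2 * #|alt2|)%N = (#|T| - 2)`!.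
Proof.
have cT2 : #|{: {z : T1 | z != y1}}| = (#|T| - 2)%N.
  rewrite card_sig; have -> : #|[pred z : T1 | z != y1]| = #|predC1 y1|.
    by apply: eq_card => z; rewrite !inE.
  by rewrite cardC1 card_T1; lia.
by rewrite (card_isog alt2_isog) card_Alt cT2 //; lia.
Qed.

End TwoPoints.

(** * The index bound for a minimal supplement *)

Section FrattiniExtension.
Variables (gT : finGroupType) (H M : {group gT}) (T : finType).
Variable pi : {morphism H >-> {perm T}}.
Hypothesis kerE : 'ker pi = M.
Hypothesis imE : pi @* H = 'Alt_T.
Hypothesis T23 : 22 < #|T|.
Hypothesis frattini : forall K : {group gT}, K \subset H -> pi @* K = 'Alt_T -> K :=: H.
Hypothesis coM : coprime (2 * #|T|) #|M|.

Let sMH : M \subset H. Proof. by rewrite -kerE subsetIl. Qed.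
Let nMH : H \subset 'N(M). Proof. by rewrite -kerE ker_norm. Qed.

Lemma frattini_supplement (K : {group gT}) : K \subset H -> M * K = H -> K :=: H.
Proof.
move=> sKH MK; apply: frattini => //.
have <- : pi @* (M * K) = pi @* K by rewrite morphimMl // -kerE morphim_ker mul1g.
by rewrite MK.
Qed.

(** By the Frattini argument the normaliser of a Sylow subgroup of [M] supplements [M], so it is
    [H]; thus all Sylow subgroups of [M] are normal. *)
Lemma frattini_nilpotent : nilpotent M.
Proof.
apply: (nilpotentS _ (Fitting_nil M)); rewrite -{1}(Sylow_gen M) gen_subG.
apply/bigcupsP=> P /SylowP[q q_pr sylP].
have nMHn : M <| H by apply/andP.
have nPH : H \subset 'N(P).
  have := Frattini_arg nMHn sylP => MN.
  by rewrite -{1}(frattini_supplement (subsetIl H 'N(P)) MN) subsetIr.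
have sPM := pHall_sub sylP.
apply: Fitting_max (pgroup_nil (pHall_pgroup sylP)).
by rewrite /normal sPM (subset_trans sMH nPH).
Qed.

Lemma odd_M : odd #|M|.
Proof. by move: coM; rewrite coprimeMl coprime2n => /andP[]. Qed.

Lemma prime_M_neq0 p : prime p -> p %| #|M| ->
  (2%:R != 0 :> 'F_p)%R /\ (#|T|%:R != 0 :> 'F_p)%R.
Proof.
move=> p_pr pM; have pch := pchar_Fp p_pr.
have nd m : m %| 2 * #|T| -> (m%:R != 0 :> 'F_p)%R.
  move=> dm; rewrite -(dvdn_pcharf pch); apply/negP=> pm.
  have := coprime_dvdr pM (coprime_dvdl (dvdn_trans pm dm) coM).
  by rewrite /coprime gcdnn => /eqP p1; rewrite p1 in p_pr.
by split; apply: nd; [exact: dvdn_mulr | exact: dvdn_mull].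
Qed.

(* A minimal generating set of M / N bounds the order of the group acting on
   it by less than the order of the simple group Alt_(k-2). *)
Lemma small_quotient_central (x y : T) (N : {group gT}) : x != y ->
  N \subset M -> pt_stab pi [set x; y] \subset 'N(N) -> abelian (M / N) ->
  2 * #|M : N| < (#|T| - 1) * (#|T| - 2) -> pt_stab pi [set x; y] / N \subset 'C(M / N).
Proof.
move=> xy sNM nNG abMN lt2; set G := pt_stab pi [set x; y] in nNG *.
have sMG : M \subset G by apply: pt_stab_subM.
have sGH : G \subset H by apply: pt_stab_sub.
have nNM := subset_trans sMG nNG.
have nUG : G / N \subset 'N(M / N) by rewrite quotient_norms // (subset_trans sGH).
have oddU : odd #|M / N|.
  by rewrite card_quotient //; apply: dvdn_odd (dvdn_indexg _ _) odd_M.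
have [d [le3 leC]] := cent_index_bound oddU nUG.
rewrite card_quotient // in le3 leC.
pose C := (coset N @*^-1 'C_(G / N)(M / N))%G.
have nNGn : N <| G by rewrite /normal nNG (subset_trans sNM).
have GE : coset N @*^-1 (G / N) = G by apply: quotientGK.
have nCG : C <| G.
  rewrite -GE cosetpre_normal /normal subsetIl normsI ?normG //.
  exact: norms_cent.
have sMC : M \subset C.
  by rewrite -sub_quotient_pre // subsetI quotientS //.
have idxC : #|G : C| = #|G / N : 'C_(G / N)(M / N)|.
  by rewrite -{1}GE index_morphpre // morphimS.
have imG : pi @* G = alt2 x y.
  apply/setP=> s; apply/morphimP/alt2P=> [[g _ gG ->]|[As sx sy]].
    have [gH gxy] := pt_stabP _ _ _ gG.
    by rewrite -imE mem_morphim // !gxy // ?set21 ?set22.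
  have [h hH hE] := pi_lift imE As; exists h => //.
  by apply/pt_stabP; split=> // z /set2P[]->; rewrite hE.
have nCG2 : pi @* C <| alt2 x y by rewrite -imG morphim_normal.
have T8 : 8 <= #|T| by apply: leq_trans T23.
have /simpleP[_ simp] := alt2_simple xy T8.
have sCG := normal_sub nCG.
case: (simp (pi @* C)%G nCG2) => [C1|CG].
  (* Then [G / M], a copy of [alt2 x y], has order at most [#|M : N| ^ d], against
     [expn_lt_fact]. *)
  exfalso; have EC : C :=: M.
    apply/eqP; rewrite eqEsubset sMC andbT -kerE.
    by apply/subsetP=> g gC; apply/kerP; [apply: (subsetP sGH); apply: (subsetP sCG) |
       apply/set1gP; rewrite -C1 mem_morphim // (subsetP sGH) // (subsetP sCG)].
  have cA : #|alt2 x y| = #|G / N : 'C_(G / N)(M / N)|.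
    by rewrite -idxC EC -imG card_morphim (setIidPr sGH) kerE.
  rewrite -cA in leC.
  have n21 : 21 <= #|T| - 2 by move: T23; clear; lia.
  have lt2' : 2 * #|M : N| < (#|T| - 2) * (#|T| - 2).+1.
      by apply: leq_trans lt2 _; rewrite mulnC leq_mul //; move: T23; clear; lia.
  have := expn_lt_fact n21 le3 lt2'.
  by rewrite -(card_alt2 xy T8) ltn_pmul2l // ltnNge leC.
have sGC : G \subset C.
  have : pi @* G \subset pi @* C by rewrite imG CG.
  by rewrite morphimSK // kerE mulSGid.
by rewrite (subset_trans (quotientS N sGC)) // cosetpreK subsetIr.
Qed.

(** A maximal subgroup [B] above [A] is normal since [M] is nilpotent; it contains the derived
    subgroup, as otherwise [M / B] would be perfect, nontrivial and soluble. *)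
Lemma nilpotent_proper_joing_der1 (A : {group gT}) :
  A \subset M -> ~~ (M \subset A) -> ~~ (M \subset A <*> M^`(1)).
Proof.
move=> sAM nMA; have nilM := frattini_nilpotent.
have [E|[B maxB sAB]] := maximal_exists sAM; first by rewrite E subxx in nMA.
have /maxgroupP[prB maxB'] := maxB; have sBM := proper_sub prB.
have nBM : M \subset 'N(B).
  have ltN := nilpotent_proper_norm nilM prB.
  have [<-|/maxB' E] : 'N_M(B) = M \/ ('N_M(B))%G \proper M.
  - have := subsetIl M 'N(B); rewrite subEproper => /predU1P[]; first by left.
    by right.
  - exact: subsetIr.
  by move: (ltN); rewrite /= (E (proper_sub ltN)) properxx.
suffices sM'B : M^`(1) \subset B.
  apply: contraL prB => sMAB; rewrite /proper sBM /= negbK.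
  by apply: subset_trans sMAB _; rewrite join_subG sAB.
apply/negPn/negP=> nM'B; have sM'M : M^`(1) \subset M by apply: der_sub.
have BM' : B <*> M^`(1) = M.
  have := joing_subl B M^`(1); set C := (B <*> M^`(1))%G => sBC.
  have : C \subset M by rewrite join_subG sBM.
  rewrite subEproper => /predU1P[//|/maxB' /(_ sBC) CB].
  by case/negP: nM'B; rewrite -CB joing_subr.
have ntQ : M / B != 1 by rewrite -subG1 quotient_sub1 //; case/andP: prB.
have ltQ := sol_der1_proper (quotient_sol B (nilpotent_sol nilM)) (subxx _) ntQ.
have E : M^`(1) / B = M / B by rewrite -[in RHS]BM' quotientYidl // (subset_trans sM'M).
by move: ltQ; rewrite -quotient_der // E properxx.
Qed.

Theorem frattini_index_bound (L : {group gT}) : L \subset H -> ~~ (M \subset L) ->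
  #|T| * (#|T| - 1) * (#|T| - 2) <= 2 * #|H : L|.
Proof.
move=> sLH nML; rewrite leqNgt; apply/negP=> ltL.
have k23 := T23; set k := #|T| in k23 ltL *; set m := #|M : L|.
have idx : (#|'Alt_T : pi @* L| * m = #|H : L|)%N.
  by have := index_morphim_ker pi sLH (subxx H); rewrite imE kerE (setIidPr sMH).
(* An odd index above 1; this is what brings the index in ['Alt_T] below ['C(k, 3)]. *)
have m3 : 3 <= m.
  have : odd m by apply: dvdn_odd (dvdn_indexg _ _) odd_M.
  have : 1 < m by rewrite indexg_gt1.
  by rewrite /m; case: #|_ : _| => [|[|[|]]].
have sQA : pi @* L \subset 'Alt_T by rewrite -imE morphimS.
set N0 := #|'Alt_T : pi @* L| in idx.
have lt6 : 6 * N0 < k * (k - 1) * (k - 2) by move: ltL m3; rewrite -idx; clear; nia.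
have [O [le_O AltO binO]] := small_index_Alt sQA (ltnW T23) lt6.
have O_le : #|O| <= k by apply: max_card.
have Ok : #|O| != k.
  apply: contra nML => /eqP Ok; have OT : O = setT by apply/eqP; rewrite eqEcard subsetT cardsT Ok leqnn.
  rewrite (frattini sLH) //; apply/eqP; rewrite eqEsubset sQA.
  apply/subsetP=> s As; apply: AltO => //; rewrite OT; exact/subsetP.
(* Here [O] misses one or two points, so ['C(k, #|O|)] is at least [k]; this leaves [m] below
   [(k - 1) * (k - 2) / 2]. *)
have kN : k <= N0.
  apply: leq_trans binO; rewrite -{1}(bin1 k) -(bin_sub (m := #|O|)) //.
  by apply: leq_bin_half; move: O_le le_O Ok k23; clear; lia.
have lt2m : 2 * m < (k - 1) * (k - 2).
  rewrite -(ltn_pmul2l (_ : 0 < k)); last by move: k23; clear; lia.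
  apply: leq_ltn_trans (_ : _ <= 2 * #|H : L|) _; last by rewrite mulnA.
  by rewrite -idx mulnCA leq_mul2l leq_mul2r kN orbT.
have [x0 [y0 [xy0 sO]]] : exists x0 y0 : T, x0 != y0 /\ ~: O \subset [set x0; y0].
  have cO : #|~: O| <= 2 by have := cardsC O; move: le_O; rewrite -/k; clear; lia.
  have /subsetPn[x0 _ xO] : ~~ (setT \subset O).
    by apply: contra Ok => /subset_leq_card; rewrite cardsT eqn_leq O_le.
  have c1 : #|~: O :\ x0| <= 1.
    by have := cardsD1 x0 (~: O); rewrite inE xO; move: cO; clear; lia.
  have [E|[y0 y0O]] := set_0Vmem (~: O :\ x0).
    have /card_gt0P[y0] : 0 < #|[set~ x0]| by rewrite cardsC1; move: k23; clear; lia.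
    rewrite !inE => yx; exists x0, y0; rewrite eq_sym; split=> //.
    apply/subsetP=> z zO; rewrite !inE; case: eqVneq => //= zx.
    by have := in_set0 z; rewrite -E !inE zx -in_setC zO.
  exists x0, y0; have := y0O; rewrite !inE => /andP[yx _]; rewrite eq_sym; split=> //.
  apply/subsetP=> z zO; rewrite !inE; case: eqVneq => //= zx.
  by rewrite (card_le1_eqP c1 z y0) // !inE zx -in_setC.
pose G := pt_stab pi [set x0; y0]; pose L1 := (L :&: G)%G.
have sMG : M \subset G by apply: pt_stab_subM.
have sGH : G \subset H by apply: pt_stab_sub.
have sL1G : L1 \subset G by apply: subsetIr.
have sL1H := subset_trans sL1G sGH.
have MLG : M * L1 = G.
  apply/eqP; rewrite eqEsubset mul_subG //; apply/subsetP=> g gG.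
  have [gH gxy] := pt_stabP _ _ _ gG.
  have /morphimP[l _ lL lE] : pi g \in pi @* L.
    apply: AltO; first by rewrite -imE mem_morphim.
    apply/subsetP=> z; rewrite inE; apply: contraR => zO; apply/eqP/gxy.
    by apply: (subsetP sO); rewrite inE.
  have lH := subsetP sLH l lL.
  apply/mulsgP; exists (g * l^-1) l; last by rewrite mulgKV.
    exact: (pi_eqM kerE).
  rewrite inE lL; apply/pt_stabP; split=> // z zxy.
  by rewrite -lE gxy.
(* [L1] normalises both factors, and [M] normalises [N] because [N] contains the derived subgroup;
   so [G = M * L1] normalises [N]. *)
pose A := (M :&: L)%G; pose N := (A <*> M^`(1))%G.
have sAM : A \subset M by apply: subsetIl.
have sNM : N \subset M by rewrite join_subG sAM der_sub.
have nMN : ~~ (M \subset N).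
  by apply: nilpotent_proper_joing_der1; rewrite // subsetI subxx.
have sM'N : M^`(1) \subset N by apply: joing_subr.
have nNG : G \subset 'N(N).
  rewrite -MLG mul_subG //; first exact: sub_der1_norm.
  have nML1 := subset_trans sL1H nMH.
  rewrite /= normsY //; last by rewrite gFnorm_trans.
  by rewrite normsI // (subset_trans (subsetIl L G)) ?normG.
have leN : #|M : N| <= m.
  have sAN : A \subset N by apply: joing_subl.
  by have := dvdn_leq (indexg_gt0 M A) (indexgS M sAN); rewrite /= indexgI.
have abMN : abelian (M / N) by apply: sub_der1_abelian.
have cMN : G / N \subset 'C(M / N).
  by apply: small_quotient_central => //; apply: leq_ltn_trans lt2m; rewrite leq_mul2l leN.
have nNM := subset_trans sMG nNG.
rewrite quotient_cents2 // in cMN.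
pose R0 := (L1 <*> N)%G.
have sNR : N \subset R0 by apply: joing_subr.
have sLR : L1 \subset R0 by apply: joing_subl.
have sRG : R0 \subset G by rewrite join_subG sL1G (subset_trans sNM).
have nRG : R0 <| G.
  rewrite /normal sRG -MLG mul_subG //; last by rewrite (subset_trans sLR) ?normG.
  by rewrite -commg_subr commGC (subset_trans (commSg M sRG)) // (subset_trans cMN).
(* The modular law: an element of [M] in [L1 * N] has its [L1] factor in [M :&: L], hence in [N]. *)
have nMR : ~~ (M \subset R0).
  apply: contra nMN; rewrite /= norm_joinEl ?(subset_trans sL1G) // => sMLN.
  apply/subsetP=> v vM; have /mulsgP[l n lL1 nN vE] := subsetP sMLN v vM.
  rewrite vE groupM //; apply: (subsetP (joing_subl A _)).
  have lE : v * n^-1 = l by rewrite vE mulgK.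
  have lL : l \in L by case/setIP: lL1.
  by apply/setIP; split=> //; rewrite -lE groupM // groupV (subsetP sNM).
have MRG : M * R0 = G.
  by apply/eqP; rewrite eqEsubset mul_subG // -{1}MLG mulgS.
have abGR : abelian (G / R0).
  rewrite -MRG quotientMidr; apply: sub_der1_abelian.
  exact: subset_trans sM'N sNR.
have ntGR : G / R0 != 1.
  by rewrite -subG1 quotient_sub1 ?normal_norm //; apply: contra nMR; apply: subset_trans.
have [K nKG pr_idx] := sol_prime_factor_exists (abelian_sol abGR) ntGR.
pose R1 := (coset R0 @*^-1 K)%G; set p := #|G / R0 : K| in pr_idx.
have GE : coset R0 @*^-1 (G / R0) = G by apply: quotientGK.
have nR1G : R1 <| G by rewrite -GE cosetpre_normal.
have idxR1 : #|G : R1| = p by rewrite -GE index_morphpre // morphimS // normal_norm.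
have sR0R1 : R0 \subset R1 by apply: sub_cosetpre.
have [chi addchi chi0] := prime_index_hom nR1G pr_idx idxR1.
have MR1 : M * R1 = G.
  by have := mulgS M sR0R1; rewrite MRG => sGM; apply/eqP; rewrite eqEsubset sGM mul_subG // normal_sub.
(* As [M] supplements [R1] in [G], the index [p] of [R1] is also that of [M :&: R1] in [M]. *)
have pM : p %| #|M|.
  suffices <- : #|M : R1| = p by apply: dvdn_indexg.
  apply/eqP; rewrite -idxR1 -(eqn_pmul2l (cardG_gt0 R1)) LagrangeMl Lagrange ?normal_sub //.
  by rewrite -MR1 (normC (subset_trans sMG (normal_norm nR1G))).
have [two0 T0] := prime_M_neq0 pr_idx pM.
have chiM := pair_hom_trivial kerE imE T23 frattini two0 T0 xy0 addchi.
have sMR1 : M \subset R1.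
  by apply/subsetP=> v vM; apply: chi0; rewrite ?(subsetP sMG) ?chiM.
have : p = 1%N by apply/eqP; rewrite -idxR1 indexg_eq1 -MR1 mul_subG.
by move=> p1; rewrite p1 in pr_idx.
Qed.

End FrattiniExtension.

(** * Passage to a minimal supplement *)

Lemma isog_quotient_morphism (gT rT : finGroupType) (H M : {group gT}) (G : {group rT}) :
  M <| H -> H / M \isog G ->
  exists pi : {morphism H >-> rT}, 'ker pi = M /\ pi @* H = G.
Proof.
move=> nMH /isogP[g injg gE]; have [sMH nM] := andP nMH.
have sHD : H \subset coset M @*^-1 (H / M) by rewrite quotientGK.
exists [morphism of restrm sHD (g \o coset M)]; split.
  rewrite ker_restrm ker_comp (trivgP injg) -[_ @*^-1 1]/('ker (coset M)) ker_coset.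
  exact/setIidPr.
by rewrite morphim_restrm setIid morphim_comp.
Qed.

(* P(H) >= k(k-1)(k-2)/2, i.e. every faithful permutation representation of H
   has degree n with 2n >= k(k-1)(k-2). *)
Theorem theorem2p2 (gT : finGroupType) (H M : {group gT}) (k : nat) :
  22 < k ->
  M <| H ->
  M :!=: 1 ->
  (H / M) \isog (Alt_k k) ->
  [complements to M in H] = set0 ->
  coprime (2 * k) #|M| ->
  forall n : nat, faithful_perm_rep H n -> (k * (k - 1) * (k - 2) <= 2 * n)%N.
Proof.
move=> k23 nMH ntM iso noC coM n [f injf].
have [pi [kerE imE]] := isog_quotient_morphism nMH iso.
have [sMH nM] := andP nMH.
pose P (K : {group gT}) := (K \subset H) && (pi @* K == 'Alt_('I_k)).
have PH : P H by rewrite /P subxx imE eqxx.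
have [H0 /mingroupP[/andP[sH0H /eqP imH0] minH0] _] := mingroup_exists PH.
pose pi0 := [morphism of restrm sH0H pi].
pose M0 := (H0 :&: M)%G.
have kerE0 : 'ker pi0 = M0 by rewrite ker_restrm kerE.
have imE0 : pi0 @* H0 = 'Alt_('I_k) by rewrite morphim_restrm setIid.
have frat (K : {group gT}) : K \subset H0 -> pi0 @* K = 'Alt_('I_k) -> K :=: H0.
  move=> sKH0 imK; apply: minH0 => //; rewrite /P (subset_trans sKH0) //=.
  by rewrite -imK morphim_restrm (setIidPr sKH0).
(* Otherwise [H0] would be a complement to [M], which the nonsplit hypothesis excludes. *)
have ntM0 : M0 :!=: 1.
  apply/eqP=> M01; have := in_set0 H0; rewrite -noC => /negbT/negP; apply.
  rewrite inE setIC; apply/andP; split; first exact/eqP.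
  rewrite eqEsubset mul_subG //; apply/subsetP=> h hH.
  have : pi h \in pi @* H0 by rewrite imH0 -imE mem_morphim.
  case/morphimP=> h0 h0H h0H0 E; apply/mulsgP; exists (h * h0^-1) h0 => //.
    rewrite -kerE; apply/kerP; first by rewrite groupM ?groupV.
    by rewrite morphM ?groupV // morphV // E mulgV.
  by rewrite mulgKV.
have [v vM0 v1] := trivgPn _ ntM0; have /setIP[vH0 vM] := vM0.
have vH := subsetP sMH v vM.
have [i fvi] : exists i, f v i != i.
  apply/existsP; apply: contraNT v1 => /existsPn fix_v; apply/eqP.
  apply: (injmP injf) => //; rewrite morph1; apply/permP=> j; rewrite perm1.
  by apply/eqP/negbNE/fix_v.
(* The stabiliser of a point moved by some element of [M0]; its index is an orbit length, hence at
   most [n]. *)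
pose L := (H0 :&: f @*^-1 'C[i | 'P])%G.
have sLH0 : L \subset H0 by apply: subsetIl.
have nML : ~~ (M0 \subset L).
  apply/subsetPn; exists v => //; apply: contra fvi.
  by case/setIP=> _ /morphpreP[_ /astab1P E]; apply/eqP.
have idx : #|H0 : L| <= n.
  rewrite -(index_injm _ injf sH0H) /= morphim_setIpre -card_orbit -[leqRHS]card_ord.
  exact: max_card.
have coM0 : coprime (2 * #|'I_k|) #|M0|.
  by rewrite card_ord (coprime_dvdr _ coM) // cardSg // subsetIr.
have k23' : 22 < #|'I_k| by rewrite card_ord.
have := frattini_index_bound kerE0 imE0 k23' frat coM0 sLH0 nML.
by rewrite card_ord => /leq_trans; apply; rewrite leq_mul2l idx.
Qed.
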